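(* Let $n\ge 1$ and $\lambda>0$. The Hilbert modules $\mathbb P_{(n)}\big(\mathbb A^{(\lambda)}(\mathbb D^n)\big)$ and $\mathbb P_{(1,\dots,1)}\big(\mathbb A^{(\lambda)}(\mathbb D^n)\big)$ over $\mathbb C[\boldsymbol z]^{\mathfrak S_n}$ are locally free of rank $1$ on $\mathbb G_n$.
   Context: $\mathbb D^n$ is the open unit polydisc in $\mathbb C^n$. For $\lambda>0$, $\mathbb A^{(\lambda)}(\mathbb D^n)$ is the Hilbert space of holomorphic functions on $\mathbb D^n$ with reproducing kernel $\prod_{j=1}^n(1-z_j\bar w_j)^{-\lambda}$. $\mathfrak S_n$ acts on $\mathbb C^n$ by $\sigma\cdot\boldsymbol z=(z_{\sigma^{-1}(1)},\dots,z_{\sigma^{-1}(n)})$. $\mathbb P_{(n)}(\mathbb A^{(\lambda)}(\mathbb D^n))$ is the subspace of $f$ with $f(\sigma^{-1}\cdot\boldsymbol z)=f(\boldsymbol z)$ for all $\sigma\in\mathfrak S_n$ (symmetric functions), and $\mathbb P_{(1,\dots,1)}(\mathbb A^{(\lambda)}(\mathbb D^n))$ is the subspace of $f$ with $f(\sigma^{-1}\cdot\boldsymbol z)=\mathrm{sgn}(\sigma)f(\boldsymbol z)$ for all $\sigma$ (anti-symmetric functions); both are Hilbert modules over the ring $\mathbb C[\boldsymbol z]^{\mathfrak S_n}$ of symmetric polynomials under pointwise multiplication. $\boldsymbol s=(s_1,\dots,s_n)$, where $s_k$ is the $k$-th elementary symmetric polynomial, and $\mathbb G_n=\boldsymbol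 s(\mathbb D^n)$. Local freeness: Since $\mathbb C[\boldsymbol z]^{\mathfrak S_n}=\mathbb C[s_1,\dots,s_n]$ is a polynomial ring in $n$ variables, a Hilbert module $\mathcal H$ over it (here a closed submodule of $\mathbb A^{(\lambda)}(\mathbb D^n)$) is a Hilbert module over $\mathbb C[u_1,\dots,u_n]$, with $q$ acting by $f\mapsto (q\circ\boldsymbol s)f$. For $\boldsymbol u\in\mathbb C^n$, $\mathbb C_{\boldsymbol u}$ is the one-dimensional module $\mathbb C$ with $q\cdot c=q(\boldsymbol u)c$, and the module tensor product $\mathcal H\otimes\mathbb C_{\boldsymbol u}$ is the quotient of $\mathcal H$ by the closed subspace generated by $\{(q\circ\boldsymbol s-q(\boldsymbol u))f: q\in\mathbb C[u_1,\dots,u_n], f\in\mathcal H\}$, identified with the orthogonal complement of that subspace in $\mathcal H$. For a bounded open connected $\Omega\subseteq\mathbb C^n$ put $\Omega^*=\{\boldsymbol v:\bar{\boldsymbol v}\in\Omega\}$. $\mathcal H$ is locally free of rank $k$ on $\Omega$ if for every $\boldsymbol w\in\Omega^*$ there are a neighbourhood $\Omega_0^*\subseteq\Omega^*$ of $\boldsymbol w$ and holomorphic functions $\gamma_1,\dots,\gamma_k:\Omega_0^*\to\mathcal H$ such that for every $\boldsymbol v\in\Omega_0^*$ the vectors $\gamma_1(\boldsymbol v),\dots,\gamma_k(\boldsymbol v)$ are linearly independent and their linear span is $\mathcal H\otimes\mathbb C_{\bar{\boldsymbol v}}$ (as a subspace of $\mathcal H$). *)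

(* Defs.v *)
From HB Require Import structures.
From mathcomp Require Import all_boot all_order all_algebra all_fingroup.
From mathcomp Require Import sesquilinear complex.
From mathcomp Require Import all_classical all_reals all_analysis.
(* mpoly is not imported: its notations clash with those of mathcomp-analysis *)
From mathcomp Require mpoly.

Set Implicit Arguments.
Unset Strict Implicit.
Unset Printing Implicit Defensive.
Import Order.TTheory GRing.Theory Num.Theory.
Import numFieldNormedType.Exports.
Local Open Scope classical_set_scope.
Local Open Scope ring_scope.

(* R[i] with its usual topology, as for every numFieldType; differentiability
   between normed modules over R[i] is then complex differentiability, i.e.
   holomorphy on open sets. *)
HB.instance Definition _ (R : realType) := NormedModule.copy R[i] R[i]^o.

Section ComplexNSpace.
Variables (R : realType) (n : nat).
Local Notation C := R[i].

Definition polydisc : set 'rV[C]_n := [set z | forall i, `|z 0 i| < 1].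

(* (sigma . z)_i = z_(sigma^-1 i) *)
Definition perm_act (sigma : 'S_n) (z : 'rV[C]_n) : 'rV[C]_n :=
  col_perm sigma^-1%g z.

Definition peval (q : mpoly.mpoly n C) (z : 'rV[C]_n) : C :=
  mpoly.meval (fun i => z 0 i) q.

(* coordinate k : 'I_n carries the elementary symmetric polynomial s_(k+1) *)
Definition symmap (z : 'rV[C]_n) : 'rV[C]_n :=
  \row_(k < n) peval (mpoly.mesym n C k.+1) z.

Definition sympolydisc : set 'rV[C]_n := symmap @` polydisc.

Definition conjv (v : 'rV[C]_n) : 'rV[C]_n := map_mx Num.conj v.

Definition conj_set (Omega : set 'rV[C]_n) : set 'rV[C]_n :=
  [set v | Omega (conjv v)].

End ComplexNSpace.

Arguments polydisc R n : clear implicits.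
Arguments sympolydisc R n : clear implicits.

(* The principal branch of a ^ x for 'Re a > 0, where the principal argument
   of a is atan ('Im a / 'Re a); only such a occur in bergman_kernel below. *)
Definition cpowR (R : realType) (a : R[i]) (x : R) : R[i] :=
  let t := x * atan (complex.Im a / complex.Re a) in
  let r := powR (complex.Re `|a|) x in
  Complex (r * cos t) (r * sin t).

Definition bergman_kernel (R : realType) (n : nat) (lambda : R)
    (z w : 'rV[R[i]]_n) : R[i] :=
  \prod_(j < n) cpowR (1 - z 0 j * (w 0 j)^*) (- lambda).

(* A Hilbert space of holomorphic functions on D. Its elements are identified
   with functions on D through hfun; the values of hfun f outside D are
   irrelevant. *)
Record holHilbert (R : realType) (n : nat) (D : set 'rV[R[i]]_n) := HolHilbert {
  hsort :> completeNormedModType R[i] ;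
  hdot : {dot hsort for @Num.conj R[i]} ;
  hnormE : forall f : hsort, `|f| ^+ 2 = hdot f f ;
  hfun : {linear hsort -> ('rV[R[i]]_n -> R[i])} ;
  hfun_inj : forall f : hsort, (forall z, D z -> hfun f z = 0) -> f = 0 ;
  hfun_hol : forall (f : hsort) z, D z -> differentiable (hfun f) z }.

Definition has_reproducing_kernel (R : realType) (n : nat)
    (D : set 'rV[R[i]]_n) (H : holHilbert D)
    (K : 'rV[R[i]]_n -> 'rV[R[i]]_n -> R[i]) : Prop :=
  forall w, D w -> exists Kw : H,
    (forall z, D z -> hfun H Kw z = K z w) /\
    (forall f : H, hdot H f Kw = hfun H f w).

Definition is_weighted_bergman (R : realType) (n : nat) (lambda : R)
    (A : holHilbert (polydisc R n)) : Prop :=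
  has_reproducing_kernel A (bergman_kernel lambda).

Section Modules.
Variables (R : realType) (n : nat) (A : holHilbert (polydisc R n)).
Local Notation C := R[i].

Definition symmetric_part : set A :=
  [set f | forall (sigma : 'S_n) z, polydisc R n z ->
    hfun A f (perm_act sigma^-1%g z) = hfun A f z].

Definition antisymmetric_part : set A :=
  [set f | forall (sigma : 'S_n) z, polydisc R n z ->
    hfun A f (perm_act sigma^-1%g z) = (-1) ^+ sigma * hfun A f z].

Definition closed_subspace (N : set A) : Prop :=
  [/\ closed N, N 0 & forall (a : C) f g, N f -> N g -> N (a *: f + g)].

(* The elements (q o s - q(u)) f, for q a polynomial and f in M. The product is
   given by its values on the polydisc: it determines g, by hfun_inj. *)
Definition shifted_multiples (M : set A) (u : 'rV[C]_n) : set A :=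
  [set g | M g /\ exists (q : mpoly.mpoly n C) (f : A), M f /\
    forall z, polydisc R n z ->
      hfun A g z = (peval q (symmap z) - peval q u) * hfun A f z].

(* M (x) C_u, realized as the orthogonal complement in M *)
Definition tensor_point (M : set A) (u : 'rV[C]_n) : set A :=
  [set f | M f /\
    forall g, smallest closed_subspace (shifted_multiples M u) g ->
      hdot A f g = 0].

Definition lin_indep (k : nat) (x : 'I_k -> A) : Prop :=
  forall c : 'I_k -> C, \sum_(i < k) c i *: x i = 0 -> forall i, c i = 0.

Definition lin_span (k : nat) (x : 'I_k -> A) : set A :=
  [set f | exists c : 'I_k -> C, f = \sum_(i < k) c i *: x i].

Definition locally_free (M : set A) (k : nat) (Omega : set 'rV[C]_n) : Prop :=
  forall w, conj_set Omega w ->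
  exists Omega0 : set 'rV[C]_n,
    [/\ open Omega0, Omega0 w, Omega0 `<=` conj_set Omega &
      exists gamma : 'I_k -> 'rV[C]_n -> A,
        (forall i v, Omega0 v -> differentiable (gamma i) v) /\
        (forall v, Omega0 v ->
          lin_indep (gamma ^~ v) /\
          lin_span (gamma ^~ v) = tensor_point M (conjv v))].

End Modules.
Arguments symmetric_part {R n} A.
Arguments antisymmetric_part {R n} A.

(* Main.v *)
(* The monomials z^a form an orthogonal total family of the weighted Bergman
   space, with squared norms 1/c_a, where (1 - t)^(-lambda) = sum_k c_k t^k and
   c_a is the product of the c_(a_i): they are obtained as limits of means of
   kernel vectors over roots of unity. The symmetrization (or the
   anti-symmetrization) P_a of z^a factors as P_a = D * (q_a o s), with q_a a
   polynomial and D a constant (or the Vandermonde determinant). A vector f of the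
   fibre over u satisfies <f, P_a> = conj(q_a(u)) <f, D>, so that it is determined
   by the number <f, D>: the fibre has dimension at most one. Conversely
     gamma(v) = (1/n!) sum_a c_a conj(q_a(conj v)) z^a
   is in the fibre over conj v, because <g, gamma(v)> = (g / D)(z) when
   s(z) = conj v. The series converges locally uniformly: a lemma of Malgrange on
   the division of polynomials bounds q_a by the supremum of P_a, and the roots of
   a polynomial depend continuously on its coefficients. Hence gamma is a locally
   uniform limit of polynomial maps, and is holomorphic by Cauchy's estimates. *)

From HB Require Import structures.
Require Import Defs.
From mathcomp Require Import all_boot all_order all_algebra all_fingroup.
From mathcomp Require Import sesquilinear complex.
From mathcomp Require Import all_classical all_reals all_analysis.
From mathcomp Require Import ring lra zify.
From mathcomp Require Import cyclic separable cyclotomic.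
From mathcomp Require Import -(notations) mpoly.

Set Implicit Arguments.
Unset Strict Implicit.
Unset Printing Implicit Defensive.
Import Order.TTheory GRing.Theory Num.Theory.
Import numFieldNormedType.Exports.
Local Open Scope classical_set_scope.
Local Open Scope ring_scope.

(** * The binomial series *)

Section BinomialCoefficients.
Variables (R : realType) (lambda : R).

(** Over s(z), when two coordinates of z coincide, the Vandermonde determinant D vanishes and
    evaluation at z kills every anti-symmetric function, so a kernel vector cannot generate the
    fibre. The generator is therefore written with the q_a, which are polynomials in u and make
    sense over every point; identities are proved where D(z) is nonzero and extended by continuity
    of gamma. Division by D spoils direct bounds near its zeros, hence Malgrange's lemma, which
    enlarges the radius from r to some rho < 1. This loss is harmless, because sum_a c_a rho^(2|a|)
    = (1 - rho^2)^(-lambda n) is finite. Placing gamma(v) over conj v makes its coefficients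
    conj(q_a(conj v)) polynomials in v. The kernel is given by the principal power, so its expansion
    has to be proved; this is done through a differential equation along the segment from 0 to x.
    Means over roots of unity are finite combinations of kernel vectors: they lie in the space, and
    their pairing with f only involves values of f. *)

Definition binc (k : nat) : R := \prod_(j < k) ((lambda + j%:R) / j.+1%:R).

Lemma binc0 : binc 0 = 1.
Proof. by rewrite /binc big_ord0. Qed.

Lemma bincS k : k.+1%:R * binc k.+1 = (lambda + k%:R) * binc k.
Proof.
rewrite /binc big_ord_recr /=; field.
by rewrite -(natrD _ 1 k) pnatr_eq0.
Qed.

Lemma binc_gt0 k : 0 < lambda -> 0 < binc k.
Proof.
move=> l0; apply: prodr_gt0 => j _; rewrite divr_gt0 ?ltr0n//.
by rewrite ltr_wpDr.
Qed.

End BinomialCoefficients.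

(** With [lambda = 2] the coefficients are the factors [k + 1] produced by term-by-term
    differentiation, so that [binc_bounded] controls those as well. *)
Lemma binc2 (R : realType) k : binc 2 k = k.+1%:R :> R.
Proof.
elim: k => [|k IH]; first by rewrite binc0.
have := bincS (2 : R) k; rewrite IH => /(congr1 (fun x => k.+1%:R^-1 * x)).
rewrite mulrA mulVf ?pnatr_eq0// mul1r => ->.
by rewrite -natrD addnC addn2 mulrC mulfK ?pnatr_eq0.
Qed.

Section RealPowerSeries.
Variable R : realType.
Implicit Types (u : nat -> R) (q s t : R).

Lemma binc_bounded (lambda : R) q : 0 < lambda -> 0 <= q < 1 ->
  exists B, forall k, binc lambda k * q ^+ k <= B.
Proof.
move=> l0 /andP[q0 q1].
have q1' : 0 < 1 - q by lra.
(* Beyond [lambda * q / (1 - q)] the ratio [(lambda + k) q / (k + 1)] of consecutive terms is at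
   most 1, so the first [m + 2] terms bound all the others. *)
pose m := Num.truncn (lambda * q / (1 - q)).
have mP : lambda * q / (1 - q) <= m.+1%:R.
  exact/ltW/truncnS_gt.
pose w k := binc lambda k * q ^+ k.
have w0 k : 0 <= w k by rewrite mulr_ge0 ?exprn_ge0// ltW// binc_gt0.
have dec k : (m < k)%N -> w k.+1 <= w k.
  move=> mk; rewrite /w.
  have -> : binc lambda k.+1 = (lambda + k%:R) / k.+1%:R * binc lambda k.
    rewrite mulrAC -bincS mulrAC mulfV ?mul1r// pnatr_eq0//.
  rewrite exprS mulrACA ler_piMl// ?w0//.
  rewrite mulrAC ler_pdivrMr ?ltr0n// mul1r.
  have : lambda * q / (1 - q) <= k%:R.
    by rewrite (le_trans mP)// ler_nat.
  rewrite ler_pdivrMr// -natr1 => h; lra.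
exists (\sum_(j < m.+2) w j) => k.
have sumge j : (j < m.+2)%N -> w j <= \sum_(j < m.+2) w j.
  move=> jm; rewrite (bigD1 (Ordinal jm))//= lerDl sumr_ge0// => i _.
have [km|km] := ltnP k m.+2; first exact: sumge.
rewrite -(subnK km); elim: (k - m.+2)%N => [|d IH].
  apply: (le_trans (dec m.+1 _)) => //; exact: sumge.
by rewrite addSn (le_trans (dec _ _))// (leq_trans _ (leq_addl _ _)).
Qed.

(** Abel's lemma: the terms are dominated by a geometric series of ratio [t / s]. *)
Lemma pseries_bounded_cvg u s t : 0 <= t < s ->
  (exists B, forall k, `|u k| * s ^+ k <= B) -> cvgn (pseries u t).
Proof.
move=> /andP[t0 ts] [B uB].
have s0 : 0 < s by exact: le_lt_trans ts.
apply: normed_cvg; apply: (@series_le_cvg _ _ (geometric B (t / s))) => [k|k|k|].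
- exact: normr_ge0.
- have B0 : 0 <= B by apply: (le_trans _ (uB 0)); rewrite mulr_ge0// exprn_ge0// ltW.
  by rewrite /= mulr_ge0// exprn_ge0// divr_ge0// ltW.
- rewrite /geometric/= normrM normrX (ger0_norm t0) expr_div_n mulrA.
  rewrite ler_pdivlMr ?exprn_gt0// mulrAC; apply: ler_wpM2r (uB k).
  exact: exprn_ge0.
- apply: is_cvg_geometric_series.
  by rewrite ger0_norm ?divr_ge0// ?(ltW s0)// ltr_pdivrMr// mul1r.
Qed.

(** The factor [k + 1] is absorbed by [(t / s) ^ k], at the cost of a smaller radius. *)
Lemma pseries_diffs_bounded u s t : 0 <= t < s ->
  (exists B, forall k, `|u k| * s ^+ k <= B) ->
  exists B, forall k, `|pseries_diffs u k| * t ^+ k <= B.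
Proof.
move=> /andP[t0 ts] [B uB].
have s0 : 0 < s by exact: le_lt_trans ts.
have [||B' B'P] := @binc_bounded 2 (t / s).
- lra.
- by rewrite divr_ge0 ?(ltW s0)//= ltr_pdivrMr// mul1r.
exists (B' * (B / s)) => k.
have := B'P k; rewrite binc2 => h1.
have h2 := uB k.+1.
rewrite /pseries_diffs normrM ger0_norm//.
have -> : k.+1%:R * `|u k.+1| * t ^+ k =
  (k.+1%:R * (t / s) ^+ k) * (`|u k.+1| * s ^+ k.+1 / s).
  rewrite expr_div_n exprS; field.
  by rewrite expf_neq0 gt_eqF.
apply: ler_pM => //.
- by rewrite mulr_ge0// exprn_ge0// divr_ge0// ltW.
- by rewrite divr_ge0 ?(ltW s0)// mulr_ge0// exprn_ge0// ltW.
- by rewrite ler_pM2r ?invr_gt0.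
Qed.

Lemma is_derive_pseries u s t : `|t| < s ->
  (exists B, forall k, `|u k| * s ^+ k <= B) ->
  is_derive t 1 (fun x => limn (pseries u x)) (limn (pseries (pseries_diffs u) t)).
Proof.
move=> ts uB.
(* Each formal derivative costs some radius: the series is controlled at [s], its first derivative
   at [s1], its second at [s2], and all three converge at [s3], beyond [|t|]. *)
pose s3 := (`|t| + s) / 2; pose s2 := (s3 + s) / 2; pose s1 := (s2 + s) / 2.
have t0 : 0 <= `|t| by [].
have s30 : `|t| < s3 by rewrite /s3; lra.
have s32 : s3 < s2 by rewrite /s2 /s3; lra.
have s21 : s2 < s1 by rewrite /s1 /s2 /s3; lra.
have s1s : s1 < s by rewrite /s1 /s2 /s3; lra.
have b1 := @pseries_diffs_bounded u s s1 _ uB.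
have b2 := @pseries_diffs_bounded _ s1 s2 _ (b1 _).
apply: (@pseries_snd_diffs _ _ s3).
- by apply: (pseries_bounded_cvg _ uB); lra.
- by apply: (pseries_bounded_cvg _ (b1 _)); lra.
- by apply: (pseries_bounded_cvg _ (b2 _ _)); lra.
- rewrite (ger0_norm (x := s3))//; lra.
Qed.

End RealPowerSeries.

(** * Complex modulus and real derivatives *)

Section ComplexModulus.
Variable R : realType.
Implicit Types (z w : R[i]).

(** The norm on [R[i]] takes its values in [R[i]]; this is the same number as an element of [R],
    where the real series live. *)
Definition cmod z : R := complex.Re `|z|.

Lemma cmodE z : (cmod z)%:C%C = `|z|.
Proof. by rewrite /cmod RRe_real// ger0_real. Qed.

Lemma cmod_ge0 z : 0 <= cmod z.
Proof. by rewrite -(@lecR R 0) cmodE normr_ge0. Qed.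

Lemma cmodX z k : cmod (z ^+ k) = cmod z ^+ k.
Proof. by apply: (@complexI R); rewrite cmodE normrX rmorphXn/= !cmodE. Qed.

Lemma norm_Re_le_cmod z : `|complex.Re z| <= cmod z.
Proof. by rewrite -lecR cmodE normc_ge_Re. Qed.

Lemma cmod_sqr z : cmod z ^+ 2 = complex.Re z ^+ 2 + complex.Im z ^+ 2.
Proof. by apply: (@complexI R); rewrite rmorphXn/= cmodE add_Re2_Im2. Qed.

Lemma norm_Im_le_cmod z : `|complex.Im z| <= cmod z.
Proof.
rewrite -(@ler_pXn2r _ 2)// ?nnegrE ?cmod_ge0//.
by rewrite cmod_sqr (real_normK (num_real (complex.Im z))) lerDr sqr_ge0.
Qed.

Lemma cmod_le_ReIm z : cmod z <= `|complex.Re z| + `|complex.Im z|.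
Proof.
rewrite -(@ler_pXn2r _ 2)// ?nnegrE ?cmod_ge0 ?addr_ge0//.
rewrite cmod_sqr -(real_normK (num_real (complex.Re z))) -(real_normK (num_real (complex.Im z))).
have a0 := normr_ge0 (complex.Re z); have b0 := normr_ge0 (complex.Im z); nra.
Qed.

Lemma cvg_complex (f : nat -> R[i]) (l : R[i]) :
  (fun n => complex.Re (f n)) @ \oo --> complex.Re l ->
  (fun n => complex.Im (f n)) @ \oo --> complex.Im l -> f @ \oo --> l.
Proof.
move=> fr fi; apply/cvgrPdist_lt => /= e e0.
have [er er0 eE] : exists2 er : R, 0 < er & e = er%:C%C.
  exists (complex.Re e); first by move: e0; rewrite ltcE/= => /andP[_].
  by rewrite RRe_real// gtr0_real.
near=> n; rewrite eE -cmodE ltcR (le_lt_trans (cmod_le_ReIm _))//.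
rewrite raddfB (raddfB (@complex.Im R)) (splitr er) ltrD//; near: n.
- by move/cvgrPdist_lt : fr; apply; rewrite divr_gt0.
- by move/cvgrPdist_lt : fi; apply; rewrite divr_gt0.
Unshelve. all: by end_near. Qed.

End ComplexModulus.

Section PointwiseDerivatives.
Variable R : realType.
Implicit Types (f g : R -> R) (t : R).

(** The differentiation rules in pointwise form, so that nesting them yields derivatives of explicit
    expressions directly. *)
Lemma is_derive1D f g t df dg : is_derive t (1 : R) f df -> is_derive t (1 : R) g dg ->
  is_derive t (1 : R) (fun x => f x + g x) (df + dg).
Proof. exact: is_deriveD. Qed.

Lemma is_derive1B f g t df dg : is_derive t (1 : R) f df -> is_derive t (1 : R) g dg ->
  is_derive t (1 : R) (fun x => f x - g x) (df - dg).
Proof. exact: is_deriveB. Qed.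

Lemma is_derive1M f g t df dg : is_derive t (1 : R) f df -> is_derive t (1 : R) g dg ->
  is_derive t (1 : R) (fun x => f x * g x) (f t * dg + g t * df).
Proof. exact: is_deriveM. Qed.

Lemma is_derive1V f t df : f t != 0 -> is_derive t (1 : R) f df ->
  is_derive t (1 : R) (fun x => (f x)^-1) (- f t ^- 2 * df).
Proof. exact: is_deriveV. Qed.

Lemma is_derive1_chain f g t df dg : is_derive (g t) (1 : R) f df ->
  is_derive t (1 : R) g dg -> is_derive t (1 : R) (fun x => f (g x)) (df * dg).
Proof. exact: is_derive1_comp. Qed.

Lemma is_derive1_const (c t : R) : is_derive t (1 : R) (fun=> c) 0.
Proof. exact: is_derive_cst. Qed.

Lemma is_derive1_ident (t : R) : is_derive t (1 : R) (fun x => x) 1.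
Proof. exact: is_derive_id. Qed.

Lemma is_derive1_0_eq f (a b : R) : a <= b ->
  (forall t, a <= t <= b -> is_derive t (1 : R) f 0) -> f a = f b.
Proof.
move=> ab df; have [||c _] := @MVT_segment R f (fun=> 0) a b ab.
- by move=> t; rewrite in_itv/= => /andP[at_ tb]; apply: df; rewrite !ltW.
- apply: derivable_within_continuous => t; rewrite in_itv/= => /df h.
  exact: ex_derive.
by rewrite mul0r => /eqP; rewrite subr_eq0 => /eqP.
Qed.

End PointwiseDerivatives.

Section BinomialSeries.
Variables (R : realType) (lambda : R) (x : R[i]).
Hypotheses (l0 : 0 < lambda) (x1 : `|x| < 1).
Local Notation a := (complex.Re x).
Local Notation b := (complex.Im x).
Let u k := binc lambda k * complex.Re (x ^+ k).
Let v k := binc lambda k * complex.Im (x ^+ k).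
(** A radius with [s > 1] and [s |x| < 1]: the series in [t] with coefficients [u] and [v] are then
    differentiable on all of [[0, 1]], endpoint included. *)
Let s := 2 / (1 + cmod x).

Let m1 : cmod x < 1.
Proof. by rewrite -ltcR cmodE. Qed.

Let s1 : 1 < s.
Proof. by have := m1; have := cmod_ge0 x => ? ?; rewrite /s ltr_pdivlMr; lra. Qed.

Let s_bounded (w : nat -> R) :
  (forall k, `|w k| <= binc lambda k * cmod x ^+ k) ->
  exists B, forall k, `|w k| * s ^+ k <= B.
Proof.
move=> hw; have m0 := cmod_ge0 x.
have [||B BP] := @binc_bounded R lambda (cmod x * s) => //.
  rewrite mulr_ge0//=; last by rewrite (le_trans _ (ltW s1)).
  by rewrite /s mulrA ltr_pdivrMr ?ltr_wpDr// ; have := m1; lra.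
exists B => k; apply: le_trans (BP k); rewrite (exprMn k (cmod x)) mulrA.
by apply: ler_wpM2r (hw k); rewrite exprn_ge0// (le_trans _ (ltW s1)).
Qed.

Let u_bounded : exists B, forall k, `|u k| * s ^+ k <= B.
Proof.
apply: s_bounded => k; rewrite /u normrM gtr0_norm ?binc_gt0//.
by rewrite ler_pM2l ?binc_gt0// -cmodX norm_Re_le_cmod.
Qed.

Let v_bounded : exists B, forall k, `|v k| * s ^+ k <= B.
Proof.
apply: s_bounded => k; rewrite /v normrM gtr0_norm ?binc_gt0//.
by rewrite ler_pM2l ?binc_gt0// -cmodX norm_Im_le_cmod.
Qed.

Let uS k : k.+1%:R * u k.+1 = (lambda + k%:R) * (a * u k - b * v k).
Proof.
rewrite /u /v mulrA bincS exprS; case: (x) (x ^+ k) => [c d] [e f] /=.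
simpc => /=; ring.
Qed.

Let vS k : k.+1%:R * v k.+1 = (lambda + k%:R) * (a * v k + b * u k).
Proof.
rewrite /u /v mulrA bincS exprS; case: (x) (x ^+ k) => [c d] [e f] /=.
simpc => /=; ring.
Qed.

Let psum (w : nat -> R) (t : R) := limn (pseries w t).
Let dsum (w : nat -> R) (t : R) := limn (pseries (pseries_diffs w) t).

(** One real component of [(1 - t x) f' = lambda x f], where [f] is the binomial series at [t x]:
    [c = - b] gives the real part and [c = b] the imaginary part. By the recurrence on the
    coefficients it holds term by term, already on partial sums. *)
Let ode (w1 w2 : nat -> R) (c t : R) : 0 <= t < s ->
  (exists B, forall k, `|w1 k| * s ^+ k <= B) ->
  (exists B, forall k, `|w2 k| * s ^+ k <= B) ->
  (forall k, k.+1%:R * w1 k.+1 = (lambda + k%:R) * (a * w1 k + c * w2 k)) ->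
  dsum w1 t - t * (a * dsum w1 t + c * dsum w2 t) = lambda * (a * psum w1 t + c * psum w2 t).
Proof.
move=> ts w1B w2B rec.
have cpsum w : (exists B, forall k, `|w k| * s ^+ k <= B) -> pseries w t @ \oo --> psum w t.
  by move=> wB; apply: (pseries_bounded_cvg ts).
have cdsum w : (exists B, forall k, `|w k| * s ^+ k <= B) ->
    pseries (pseries_diffs w) t @ \oo --> dsum w t.
  move=> wB; apply: (@pseries_bounded_cvg _ _ ((t + s) / 2)); first lra.
  by apply: pseries_diffs_bounded wB; lra.
have cE w : (exists B, forall k, `|w k| * s ^+ k <= B) ->
    series (fun i => i%:R * w i * t ^+ i.-1) @ \oo --> dsum w t.
  by move=> /cdsum/cvgP; exact: pseries_diffs_equiv.
apply/eqP; rewrite subr_eq; apply/eqP.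
apply: (@cvg_unique _ _ (pseries (pseries_diffs w1) t @ \oo)) => //; first exact: cdsum.
have : (fun N => lambda * (a * pseries w1 t N + c * pseries w2 t N)
  + t * (a * series (fun i => i%:R * w1 i * t ^+ i.-1) N
         + c * series (fun i => i%:R * w2 i * t ^+ i.-1) N)) @ \oo -->
  lambda * (a * psum w1 t + c * psum w2 t) + t * (a * dsum w1 t + c * dsum w2 t).
  apply: cvgD; (apply: cvgM; first exact: cvg_cst); apply: cvgD;
    (apply: cvgM; first exact: cvg_cst); by [exact: cpsum|exact: cE].
apply: cvg_trans; apply: near_eq_cvg; apply: nearW => N.
rewrite /pseries /series /=.
rewrite 4!mulr_sumr -!big_split/= 2!mulr_sumr -!big_split/=.
apply: eq_bigr => -[|i] _; rewrite /pseries_diffs [X in _ = X * _]rec ?expr0 /=; first ring.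
rewrite exprS; ring.
Qed.

Let psum0 (w : nat -> R) : psum w 0 = w 0.
Proof.
rewrite /psum; apply: (@cvg_lim _ _ _ _ _ (pseries w 0)) => //.
apply: cvg_near_cst; exists 1 => // -[//|N] _ /=.
rewrite /pseries /series /= big_nat_recl//= expr0 mulr1 big1_seq ?addr0//.
by move=> i _; rewrite expr0n/= mulr0.
Qed.

Let den_gt0 (t : R) : 0 <= t <= 1 -> 0 < 1 - t * a.
Proof.
move=> /andP[t0 t1]; have := m1; have := norm_Re_le_cmod x; rewrite ler_norml => /andP[h1 h2] h3.
have h4 : t * a <= t * cmod x by rewrite ler_wpM2l.
have h5 : t * cmod x <= cmod x by rewrite ler_piMl ?cmod_ge0.
lra.
Qed.

(** [p + i q = 1 - t x], [rho] is its squared modulus, and [U + i V] its power of exponent [lambda],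
    the arctangent being the principal argument because [p > 0] on [[0, 1]]. The exponent is
    opposite to that of the series, so that the product should be the constant 1. *)
Let p (t : R) := 1 - t * a.
Let q (t : R) := 0 - t * b.
Let rho t := p t * p t + q t * q t.
Let E t := expR (lambda / 2 * ln (rho t)).
Let U t := E t * cos (lambda * atan (q t / p t)).
Let V t := E t * sin (lambda * atan (q t / p t)).

Let rho_gt0 t : 0 <= t <= 1 -> 0 < rho t.
Proof.
by move=> /den_gt0 h; rewrite ltr_wpDr -?expr2 ?sqr_ge0// exprn_gt0.
Qed.

(** Components of [- lambda x / (1 - t x)] times [U + i V], with [x / (1 - t x)] written as
    [x conj(1 - t x) / rho]. *)
Let dUV (t : R) : 0 <= t <= 1 ->
  is_derive t (1 : R) U
    (- lambda / rho t * ((a * p t + b * q t) * U t - (b * p t - a * q t) * V t)) /\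
  is_derive t (1 : R) V
    (- lambda / rho t * ((a * p t + b * q t) * V t + (b * p t - a * q t) * U t)).
Proof.
move=> t01; have p0 := den_gt0 t01; have r0 := rho_gt0 t01.
have p0' : p t != 0 by rewrite gt_eqF.
have dp : is_derive t (1 : R) p (- a).
  apply: is_derive_eq (is_derive1B (is_derive1_const _ _)
    (is_derive1M (is_derive1_ident _) (is_derive1_const _ _))) _.
  ring.
have dq : is_derive t (1 : R) q (- b).
  apply: is_derive_eq (is_derive1B (is_derive1_const _ _)
    (is_derive1M (is_derive1_ident _) (is_derive1_const _ _))) _.
  ring.
have dr := is_derive1D (is_derive1M dp dp) (is_derive1M dq dq).
have dE : is_derive t (1 : R) E _ := is_derive1_chain (is_derive_expR _)
  (is_derive1M (is_derive1_const (lambda / 2) t) (is_derive1_chain (is_derive1_ln r0) dr)).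
have dth := is_derive1M (is_derive1_const lambda t)
  (is_derive1_chain (is_derive1_atan _) (is_derive1M dq (is_derive1V p0' dp))).
have dc := is_derive1M dE (is_derive1_chain (is_derive_cos _) dth).
have ds := is_derive1M dE (is_derive1_chain (is_derive_sin _) dth).
have h1 : 1 + (q t / p t) ^+ 2 != 0 by rewrite gt_eqF// ltr_pwDl// sqr_ge0.
have h2 : p t * p t + q t * q t != 0 by rewrite gt_eqF.
split.
- apply: is_derive_eq dc _; rewrite /U /V -/(E t) /rho.
  move: (E t) (cos _) (sin _) => e c s'.
  by field; rewrite ?h1 ?h2 ?p0'.
- apply: is_derive_eq ds _; rewrite /U /V -/(E t) /rho.
  move: (E t) (cos _) (sin _) => e c s'.
  by field; rewrite ?h1 ?h2 ?p0'.
Qed.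

Let dS (w : nat -> R) (t : R) : 0 <= t <= 1 ->
  (exists B, forall k, `|w k| * s ^+ k <= B) ->
  is_derive t (1 : R) (psum w) (dsum w t).
Proof.
move=> /andP[t0 t1] wB; apply: is_derive_pseries wB.
by rewrite ger0_norm// (le_lt_trans t1).
Qed.

(* The product of the series at [t x] and of [(1 - t x) ^ lambda], whose real and
   imaginary parts are U and V, has zero derivative on [0, 1]. *)
Let prod_eq : psum u 1 * U 1 - psum v 1 * V 1 = 1 /\
  psum u 1 * V 1 + psum v 1 * U 1 = 0.
Proof.
have odeuv t : 0 <= t <= 1 ->
    dsum u t = lambda / rho t * ((a * p t + b * q t) * psum u t - (b * p t - a * q t) * psum v t) /\
    dsum v t = lambda / rho t * ((a * p t + b * q t) * psum v t + (b * p t - a * q t) * psum u t).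
  move=> t01; have r0 := rho_gt0 t01.
  have ts : 0 <= t < s by move: t01 => /andP[-> t1]; exact: le_lt_trans s1.
  have h1 : dsum u t - t * (a * dsum u t + - b * dsum v t) =
      lambda * (a * psum u t + - b * psum v t).
    by apply: ode => // k; rewrite uS mulNr.
  have h2 : dsum v t - t * (a * dsum v t + b * dsum u t) = lambda * (a * psum v t + b * psum u t).
    by apply: ode => // k; rewrite vS.
  have r0' : rho t != 0 by rewrite gt_eqF.
  have e1 : p t * dsum u t - q t * dsum v t = lambda * (a * psum u t - b * psum v t).
    rewrite -[in RHS]mulNr -h1 /p /q; ring.
  have e2 : p t * dsum v t + q t * dsum u t = lambda * (a * psum v t + b * psum u t).
    rewrite -h2 /p /q; ring.
  (* Multiplying [(1 - t x) f' = lambda x f] by [conj(1 - t x)] separates the two components of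
     [f']. *)
  split; apply: (mulfI r0').
  - transitivity (p t * (p t * dsum u t - q t * dsum v t) +
      q t * (p t * dsum v t + q t * dsum u t)).
      rewrite /rho; ring.
    rewrite e1 e2; field; exact: r0'.
  - transitivity (p t * (p t * dsum v t + q t * dsum u t) -
      q t * (p t * dsum u t - q t * dsum v t)).
      rewrite /rho; ring.
    rewrite e1 e2; field; exact: r0'.
have U0 : U 0 = 1.
  by rewrite /U /E /rho /p /q !(mul0r, subr0) atan0 !mulr0 cos0 mulr1 mul1r addr0 ln1 mulr0 expR0.
have V0 : V 0 = 0.
  by rewrite /V /E /rho /p /q !(mul0r, subr0) atan0 !mulr0 sin0 mulr0.
have u0 : psum u 0 = 1 by rewrite psum0 /u binc0 expr0 mul1r.
have v0 : psum v 0 = 0 by rewrite psum0 /v expr0 mulr0.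
have -> : psum u 1 * U 1 - psum v 1 * V 1 = psum u 0 * U 0 - psum v 0 * V 0.
  symmetry; apply: (@is_derive1_0_eq _ (fun t => psum u t * U t - psum v t * V t)) => // t t01.
  have [dU dV] := dUV t01; have [eu ev] := odeuv t t01.
  apply: is_derive_eq (is_derive1B (is_derive1M (dS t01 u_bounded) dU)
    (is_derive1M (dS t01 v_bounded) dV)) _.
  by rewrite eu ev; ring.
have -> : psum u 1 * V 1 + psum v 1 * U 1 = psum u 0 * V 0 + psum v 0 * U 0.
  symmetry; apply: (@is_derive1_0_eq _ (fun t => psum u t * V t + psum v t * U t)) => // t t01.
  have [dU dV] := dUV t01; have [eu ev] := odeuv t t01.
  apply: is_derive_eq (is_derive1D (is_derive1M (dS t01 u_bounded) dV)
    (is_derive1M (dS t01 v_bounded) dU)) _.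
  by rewrite eu ev; ring.
by rewrite U0 V0 u0 v0 mulr1 !mulr0 subr0 mul0r addr0.
Qed.

Lemma binomial_series :
  (fun N => \sum_(k < N) (binc lambda k)%:C%C * x ^+ k) @ \oo --> cpowR (1 - x) (- lambda).
Proof.
have t1 : 0 <= (1 : R) <= 1 by rewrite ler01 lexx.
have r0 := rho_gt0 t1; have p0 := den_gt0 t1; have [e1 e2] := prod_eq.
have UV : U 1 ^+ 2 + V 1 ^+ 2 = E 1 ^+ 2.
  rewrite /U /V !exprMn -mulrDr cos2Dsin2 mulr1//.
have E0 : E 1 != 0 by rewrite gt_eqF// expR_gt0.
have modE : complex.Re `|1 - x| `^ (- lambda) = (E 1)^-1.
  have -> : complex.Re `|1 - x| = Num.sqrt (rho 1).
    rewrite normc_def/=; congr Num.sqrt; rewrite /rho /p /q !mul1r.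
    by case: (x) => c d /=; rewrite !expr2.
  rewrite -powR12_sqrt ?(ltW r0)// -powRrM /E /powR (gt_eqF r0) -expRN; congr expR.
  by field.
have argE : atan (complex.Im (1 - x) / complex.Re (1 - x)) = atan (q 1 / p 1).
  by rewrite /p /q !mul1r; case: (x).
(* The series at 1 is the inverse of [U 1 + i V 1], that is, its conjugate divided by the squared
   modulus [E 1 ^+ 2]. *)
have cP : cpowR (1 - x) (- lambda) = Complex (psum u 1) (psum v 1).
  rewrite /cpowR modE argE mulNr cosN sinN.
  have e3 : psum u 1 * E 1 ^+ 2 = U 1.
    rewrite -UV; transitivity (U 1 * (psum u 1 * U 1 - psum v 1 * V 1) +
      V 1 * (psum u 1 * V 1 + psum v 1 * U 1)).
      ring.
    rewrite e1 e2; ring.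
  have e4 : psum v 1 * E 1 ^+ 2 = - V 1.
    rewrite -UV; transitivity (U 1 * (psum u 1 * V 1 + psum v 1 * U 1) -
      V 1 * (psum u 1 * U 1 - psum v 1 * V 1)).
      ring.
    rewrite e1 e2; ring.
  congr Complex; apply: (mulIf (expf_neq0 2 E0)); rewrite ?e3 ?e4 /U /V; field; exact: E0.
rewrite cP; apply: cvg_complex => /=.
- have := @pseries_bounded_cvg _ u s 1 _ u_bounded; rewrite ler01 s1 => /(_ isT).
  rewrite -/(psum u 1); apply: cvg_trans; apply: near_eq_cvg; apply: nearW => N.
  rewrite /pseries /series/= raddf_sum big_mkord; apply: eq_bigr => k _.
  by rewrite expr1n mulr1 /u; case: (x ^+ k) => c d /=; simpc.
- have := @pseries_bounded_cvg _ v s 1 _ v_bounded; rewrite ler01 s1 => /(_ isT).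
  rewrite -/(psum v 1); apply: cvg_trans; apply: near_eq_cvg; apply: nearW => N.
  rewrite /pseries /series/= raddf_sum big_mkord; apply: eq_bigr => k _.
  by rewrite expr1n mulr1 /v; case: (x ^+ k) => c d /=; simpc.
Qed.

End BinomialSeries.

(** * Means over roots of unity *)

Section RootsOfUnity.
Variable C : numClosedFieldType.

Lemma conjCM (x y : C) : (x * y)^* = x^* * y^*.
Proof. exact: rmorphM. Qed.

Lemma conjCX (x : C) k : (x ^+ k)^* = x^* ^+ k.
Proof. exact: rmorphXn. Qed.

Lemma conjC_sum I r (P : pred I) (F : I -> C) :
  (\sum_(i <- r | P i) F i)^* = \sum_(i <- r | P i) (F i)^*.
Proof. exact: rmorph_sum. Qed.

(** [X^N - 1] is separable in characteristic 0, so it has [N] distinct roots, and a finite group of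
    roots of unity in a field is cyclic. *)
Lemma prim_root_exists N : (0 < N)%N -> exists w : C, N.-primitive_root w.
Proof.
move=> N0; pose p : {poly C} := 'X^N - 1.
have [r Dp] := closed_field_poly_normal p.
rewrite (monicP _) ?monicXnsubC // scale1r in Dp.
have rn1 : all N.-unity_root r by apply/allP => z; rewrite -root_prod_XsubC -Dp.
have sz_r : (N < (size r).+1)%N by rewrite -(size_prod_XsubC r id) -Dp size_XnsubC.
have [|z _ zP] := hasP (has_prim_root N0 rn1 _ sz_r); last by exists z.
by rewrite -separable_prod_XsubC -Dp separable_Xn_sub_1// pnatr_eq0 -lt0n.
Qed.

Lemma norm_prim_root N (w : C) : N.-primitive_root w -> `|w| = 1.
Proof.
move=> w1; apply/eqP; rewrite -(@pexpr_eq1 _ _ N) ?(prim_order_gt0 w1)//.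
by rewrite -normrX (prim_expr_order w1) normr1.
Qed.

Lemma norm1_conjM (w : C) : `|w| = 1 -> w^* * w = 1.
Proof. by move=> w1; rewrite mulrC -normCK w1 expr1n. Qed.

Lemma prim_root_sum N (w : C) k m : N.-primitive_root w -> (k < N)%N -> (m < N)%N ->
  \sum_(j < N) (w ^+ j)^* ^+ m * (w ^+ j) ^+ k = (if k == m then N%:R else 0).
Proof.
move=> w1 kN mN; have wn := norm_prim_root w1.
have wj j : `|w ^+ j| = 1 by rewrite normrX wn expr1n.
case: eqP => [->|/eqP km].
  rewrite (eq_bigr (fun=> 1)) ?sumr_const ?card_ord// => j _.
  by rewrite -exprMn norm1_conjM// expr1n.
(* [N - m] in place of [- m] keeps the exponent natural, and [e] is the ratio of a geometric sum. It
   differs from 1 because [k + N - m] lies strictly between 0 and [2 N] and is not [N]. *)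
pose e := w ^+ (k + (N - m)).
have eE j : (w ^+ j)^* ^+ m * (w ^+ j) ^+ k = e ^+ j.
  have wm : ((w ^+ j) ^+ m)^* = (w ^+ j) ^+ (N - m).
    apply: (mulIf (x := (w ^+ j) ^+ m)).
      by rewrite -normr_gt0 normrX wj expr1n.
    rewrite norm1_conjM; last by rewrite normrX wj expr1n.
    by rewrite -exprD subnK ?(ltnW mN)// -exprM mulnC exprM (prim_expr_order w1) expr1n.
  by rewrite -conjCX wm -exprD -!exprM [(N - m + k)%N]addnC mulnC.
under eq_bigr do rewrite eE.
have e1 : e - 1 != 0.
  rewrite subr_eq0 -(prim_order_dvd w1); apply/negP => /dvdnP[c cE].
  move: km kN mN cE; case: c => [|[|c]] => /eqP; first by lia.
    by lia.
  by rewrite !mulSn; lia.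
apply: (mulfI e1); rewrite mulr0 -subrX1 -exprM mulnC exprM (prim_expr_order w1).
by rewrite expr1n subrr.
Qed.

Lemma dft_coef (V : lmodType C) N (w : C) (a : nat -> V) k : N.-primitive_root w -> (k < N)%N ->
  \sum_(j < N) (w ^+ j)^* ^+ k *: (\sum_(m < N) (w ^+ j) ^+ m *: a m) = N%:R *: a k.
Proof.
move=> w1 kN; under eq_bigr do rewrite scaler_sumr.
rewrite exchange_big/= (bigD1 (Ordinal kN))//= [X in _ + X]big1 ?addr0 => [|i ik].
  under eq_bigr do rewrite scalerA.
  by rewrite -scaler_suml prim_root_sum// eqxx.
under eq_bigr do rewrite scalerA.
by rewrite -scaler_suml prim_root_sum// -[_ == k]/(i == Ordinal kN) (negbTE ik) scale0r.
Qed.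

(* Cauchy's estimate for a polynomial with vector coefficients, the mean over
   the circle being replaced by a mean over roots of unity. *)
Lemma coef_le_circle (V : normedModType C) N (a : nat -> V) (B : C) :
  (forall t : C, `|t| = 1 -> `|\sum_(m < N) t ^+ m *: a m| <= B) ->
  forall k, (k < N)%N -> `|a k| <= B.
Proof.
move=> aB k kN; have [w w1] := prim_root_exists (leq_ltn_trans (leq0n k) kN).
have N0 : 0 < N%:R :> C by rewrite ltr0n (leq_ltn_trans (leq0n k) kN).
have wj j : `|w ^+ j| = 1 by rewrite normrX (norm_prim_root w1) expr1n.
rewrite -(ler_pM2l N0) -[in leLHS](ger0_norm (ltW N0)) -normrZ -(dft_coef _ w1 kN).
apply: (le_trans (ler_norm_sum _ _ _)); rewrite mulr_natl -[X in _ *+ X]card_ord -sumr_const.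
apply: ler_sum => j _; rewrite normrZ normrX norm_conjC wj expr1n mul1r.
exact: aB.
Qed.

(* The reversed conjugate polynomial [t ^+ m * (p.[t])^*] has on the unit circle
   the modulus of [p], while its value at 0 is the conjugate of [p`_m]. *)
Lemma malgrange (p q : {poly C}) m (B : C) : (size p <= m.+1)%N ->
  (forall t : C, `|t| = 1 -> `|p.[t] * q.[t]| <= B) -> `|p`_m| * `|q.[0]| <= B.
Proof.
move=> sp pqB; pose p' := \poly_(k < m.+1) (p`_(m - k))^*.
have p'E (t : C) : `|t| = 1 -> p'.[t] = t ^+ m * (p.[t])^*.
  move=> t1; rewrite horner_poly (horner_coef_wide _ sp) conjC_sum mulr_sumr.
  rewrite (reindex_inj rev_ord_inj)/=; apply: eq_bigr => k _.
  rewrite subSS subKn ?leq_ord// conjCM conjCX mulrCA; congr (_ * _).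
  rewrite -[X in t ^+ X](subnK (leq_ord k)) exprD -mulrA -exprMn [t * _]mulrC.
  by rewrite norm1_conjM// expr1n mulr1.
pose r := p' * q.
have r0 : r`_0 = (p`_m)^* * q.[0].
  by rewrite coef0M coef_poly/= subn0 horner_coef0.
have -> : `|p`_m| * `|q.[0]| = `|r`_0| by rewrite r0 normrM norm_conjC.
apply: (@coef_le_circle C^o (size r).+1 (fun k => r`_k : C^o)) => // t t1.
have -> : \sum_(k < (size r).+1) t ^+ k *: (r`_k : C^o) = r.[t].
  by rewrite (horner_coef_wide _ (leqnSn _)); apply: eq_bigr => k _; rewrite mulrC.
by rewrite hornerM p'E// !normrM norm_conjC normrX t1 expr1n mul1r -normrM pqB.
Qed.

End RootsOfUnity.

(** * Locally uniform limits of polynomial maps *)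

Section UniformLimits.
Variables (C : numClosedFieldType) (E : normedModType C).

(** Polynomial along every complex line through [v], with coefficients that depend on the direction
    [h] and a length [d] that does not. Only the first-order coefficient, the future differential,
    must be linear in [h]. Coefficients vanish from [d] on, so that sums of different lengths can be
    aligned. *)
Definition polynomial_at (V : lmodType C) (F : E -> V) (v : E) : Prop :=
  exists (d : nat) (a : nat -> E -> V),
    [/\ forall k h, (d <= k)%N -> a k h = 0,
        linear (a 1) &
        forall h t, F (v + t *: h) = \sum_(k < d) t ^+ k *: a k h].

Lemma sum_ord_widen0 (V : nmodType) (a : nat -> V) d D : (d <= D)%N ->
  (forall k, (d <= k)%N -> a k = 0) -> \sum_(k < d) a k = \sum_(k < D) a k.
Proof.
move=> dD a0; rewrite (big_ord_widen _ _ dD) [RHS](bigID (fun k : 'I_D => k < d)%N)/=.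
by rewrite [X in _ = _ + X]big1 ?addr0// => k; rewrite -leqNgt => /a0.
Qed.

Lemma polynomial_atZ_sum (V : lmodType C) (I : Type) (s : seq I) (P : pred I)
    (f : I -> E -> C) (x : I -> V) v :
  (forall i, polynomial_at (f i : E -> C^o) v) ->
  polynomial_at (fun w => \sum_(i <- s | P i) f i w *: x i) v.
Proof.
move=> fP; elim: s => [|i s [d [a [a0 aL aE]]]].
  exists 0, (fun _ _ => 0); split => //.
    by move=> c y z; rewrite scaler0 addr0.
  by move=> h t; rewrite big_nil big_ord0.
have [d' [b [b0 bL bE]]] := fP i.
exists (maxn d d'), (fun k h => (if P i then b k h *: x i else 0) + a k h); split.
- move=> k h; rewrite geq_max => /andP[dk d'k]; rewrite a0// b0// scale0r.
  by case: ifP; rewrite addr0.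
- move=> c y z; rewrite aL bL; case: ifP => _; last by rewrite !add0r.
  by rewrite scalerDr scalerDl -scalerA -!addrA; congr (_ + _); rewrite addrCA.
- move=> h t; rewrite big_cons aE bE.
  rewrite (@sum_ord_widen0 _ (fun k => t ^+ k *: a k h) _ _ (leq_maxl d d')); last first.
    by move=> k dk; rewrite a0// scaler0.
  rewrite (@sum_ord_widen0 _ (fun k => t ^+ k *: b k h : C^o) _ _ (leq_maxr d d')); last first.
    by move=> k dk; rewrite b0// scaler0.
  under [in RHS]eq_bigr do rewrite scalerDr.
  rewrite big_split/=; case: ifP => _; last first.
    by rewrite [X in X + _]big1 ?add0r// => k _; rewrite scaler0.
  by rewrite scaler_suml; under [in RHS]eq_bigr do rewrite scalerA.
Qed.

Lemma geometric_sum_le2 (x : C) d : 0 <= x -> 2 * x <= 1 -> \sum_(k < d) x ^+ k <= 2.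
Proof.
move=> x0 x1; have h := subrX1 x d.
have s0 : 0 <= \sum_(k < d) x ^+ k by apply: sumr_ge0 => k _; rewrite exprn_ge0.
have xd : 0 <= x ^+ d by rewrite exprn_ge0.
set s := \sum_(k < d) _ in h s0 *.
have e : 2 - s = 2 * x ^+ d + (1 - 2 * x) * s.
  have -> : x ^+ d = 1 + (x - 1) * s by rewrite -h addrC subrK.
  ring.
by rewrite -subr_ge0 e addr_ge0// mulr_ge0// subr_ge0.
Qed.

Variable (V : completeNormedModType C).

Lemma polynomial_at_coef_le (F : E -> V) v (r B : C) (d : nat) (a : nat -> E -> V) :
  (forall h t, F (v + t *: h) = \sum_(k < d) t ^+ k *: a k h) ->
  (forall h, `|h| <= r -> `|F (v + h)| <= B) ->
  forall k h, (k < d)%N -> `|h| <= r -> `|a k h| <= B.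
Proof.
move=> aE FB k h kd hr.
apply: (@coef_le_circle _ _ d (fun k => a k h)) => // t t1.
by rewrite -aE FB// normrZ t1 mul1r.
Qed.

Lemma norm_lim_le (u : nat -> V) l (b : C) :
  u @ \oo --> l -> (forall N, `|u N| <= b) -> `|l| <= b.
Proof.
move=> ul ub; apply/ler_addgt0Pr => e e0.
have [N _ /(_ N (leqnn N)) h] : \forall N \near \oo, `|l - u N| <= e.
  by move/cvgrPdist_le : ul; apply.
by rewrite -(subrK (u N) l) (le_trans (ler_normD _ _))// addrC lerD.
Qed.

(* Along every line through v the maps are polynomials, so Cauchy's estimates
   control their derivatives at v, and the second order remainders, by their
   supremum on the ball: both pass to the limit. *)
Lemma uniform_limit_differentiable (F : nat -> E -> V) (G : E -> V) (v : E) (r B : C) :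
  0 < r -> (forall N, polynomial_at (F N) v) ->
  (forall N h, `|h| <= r -> `|F N (v + h)| <= B) ->
  (forall e, 0 < e -> exists N0, forall i j, (N0 <= i)%N -> (N0 <= j)%N ->
    forall h, `|h| <= r -> `|F i (v + h) - F j (v + h)| <= e) ->
  (forall h, `|h| <= r -> F ^~ (v + h) @ \oo --> G (v + h)) ->
  differentiable G v.
Proof.
move=> r0 Fp FB Fc FG.
have [d0 d0P] := choice Fp; have [a0 aP] := choice d0P.
(* At least two coefficients, so that orders 0 and 1 can be split off the sum. *)
pose d N := (d0 N).+2.
have a_0 N k h : (d N <= k)%N -> a0 N k h = 0.
  by move=> dk; have [+ _ _] := aP N; apply; rewrite (leq_trans _ dk)// /d; lia.
have aL N : linear (a0 N 1%N) by have [] := aP N.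
have aE N h t : F N (v + t *: h) = \sum_(k < d N) t ^+ k *: a0 N k h.
  have [z _ ->] := aP N; apply: (@sum_ord_widen0 _ (fun k => t ^+ k *: a0 N k h)).
     by rewrite /d; lia.
  by move=> k dk; rewrite z// scaler0.
have B0 : 0 <= B by apply: le_trans (FB 0%N 0 _) => //; rewrite normr0 ltW.
have aB N k h : (k < d N)%N -> `|h| <= r -> `|a0 N k h| <= B.
  by apply: (polynomial_at_coef_le (aE N)) => h'; exact: FB.
have a00 N h : a0 N 0%N h = F N v.
  have := aE N h 0; rewrite scale0r addr0 => ->.
  rewrite big_ord_recl/= expr0 scale1r big1 ?addr0// => i _.
  by rewrite /bump/= exprS mul0r scale0r.
have scaleE (h : E) : h != 0 -> exists c h', [/\ h = c *: h', `|h'| = r, 0 <= c & c = `|h| / r].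
  move=> h0; exists (`|h| / r), ((r / `|h|) *: h); split => //.
  - rewrite scalerA mulrA divfK ?gt_eqF// divff ?normr_eq0// scale1r//.
  - by rewrite normrZ normrM normfV normr_id divfK ?normr_eq0// gtr0_norm.
  - by rewrite divr_ge0// ltW.
have aZ N c h : a0 N 1%N (c *: h) = c *: a0 N 1%N h.
  have z : a0 N 1%N 0 = 0.
    by have := aL N (-1) 0 0; rewrite scaler0 addr0 scaleN1r addNr.
  by have := aL N c h 0; rewrite addr0 z addr0.
have lin_bound (l : E -> V) (e : C) : (forall c h, l (c *: h) = c *: l h) ->
    (forall h, `|h| <= r -> `|l h| <= e) -> forall h, `|l h| <= e / r * `|h|.
  move=> lZ le h; have [->|h0] := eqVneq h 0.
    by have := lZ 0 0; rewrite !scale0r => ->; rewrite !normr0 mulr0.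
  have [c [h' [hE h'r c0 cE]]] := scaleE h h0.
  have -> : e / r * `|h| = c * e by rewrite cE; ring.
  rewrite {1}hE lZ normrZ (ger0_norm c0); apply: ler_wpM2l => //.
  by apply: le; rewrite h'r.
have Lc h : cvgn (fun N => a0 N 1%N h).
  apply/cauchy_cvgP/cauchy_ballP => e e0; rewrite !near_map2 -ball_normE /=.
  (* Chosen so that [e' / r * |h| < e]; the summand 1 takes care of [h = 0]. *)
  pose e' := e * r / (2 * (1 + `|h|)).
  have h1 : 0 < 1 + `|h| by rewrite ltr_pwDl.
  have e'0 : 0 < e' by rewrite divr_gt0 ?mulr_gt0.
  have [N0 N0P] := Fc _ e'0; near=> i j.
  have ij : `|a0 i 1%N h - a0 j 1%N h| <= e' / r * `|h|.
    apply: (lin_bound (fun h => a0 i 1%N h - a0 j 1%N h)) => [c h'|h' h'r].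
      by rewrite !aZ scalerBr.
    pose D := maxn (d i) (d j).
    apply: (@polynomial_at_coef_le (fun w => F i w - F j w) v r e' D
      (fun k h => a0 i k h - a0 j k h)) => //.
    - move=> h1' t; rewrite !aE.
      rewrite (@sum_ord_widen0 _ (fun k => t ^+ k *: a0 i k h1') _ _ (leq_maxl (d i) (d j)));
        last first.
        by move=> k dk; rewrite a_0// scaler0.
      rewrite (@sum_ord_widen0 _ (fun k => t ^+ k *: a0 j k h1') _ _ (leq_maxr (d i) (d j)));
        last first.
        by move=> k dk; rewrite a_0// scaler0.
      by rewrite -sumrB; apply: eq_bigr => k _; rewrite scalerBr.
    - apply: N0P; [near: i|near: j]; exact: nbhs_infty_ge.
    - by rewrite /D /d leq_max; lia.
  apply: (le_lt_trans ij); rewrite /e' -[X in _ < X]mulr1.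
  have -> : e * r / (2 * (1 + `|h|)) / r * `|h| = e * `|h| / (2 * (1 + `|h|)).
    by field; rewrite !gt_eqF.
  rewrite mulr1 ltr_pdivrMr ?mulr_gt0// ltr_pM2l// -subr_gt0.
  by rewrite mulrDr mulr1 mulr_natl mulr2n addrA addrK ltr_pwDl.
pose L h := limn (fun N => a0 N 1%N h).
have LE h : (fun N => a0 N 1%N h) @ \oo --> L h := Lc h.
have Llin : linear L.
  move=> c y z; apply: cvg_lim => //.
  have -> : (fun N => a0 N 1%N (c *: y + z)) = (fun N => c *: a0 N 1%N y + a0 N 1%N z).
    by apply/funext => N; rewrite aL.
  by apply: cvgD => //; apply: cvgZl_tmp.
have LB h : `|L h| <= B / r * `|h|.
  apply: (norm_lim_le (LE h)) => N; apply: lin_bound => [c h'|h' h'r]; first exact: aZ.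
  exact: aB.
(* With [c = |k| / r <= 1/2], the terms of order at least 2 are bounded by
   [B c^2 (1 + c + c^2 + ...) <= 2 B c^2], uniformly in [N]. *)
have rem k : 2 * `|k| <= r -> `|G (v + k) - G v - L k| <= 2 * B / r ^+ 2 * `|k| ^+ 2.
  move=> kr; have kr' : `|k| <= r.
    by apply: le_trans kr; rewrite mulr_natl mulr2n lerDl.
  have c0 : (fun N => F N (v + k) - F N v - a0 N 1%N k) @ \oo --> G (v + k) - G v - L k.
    apply: cvgB => //; apply: cvgB; first exact: FG.
    by have := FG 0; rewrite normr0 addr0; apply; exact: ltW.
  apply: (norm_lim_le c0) => N; have [k0|k0] := eqVneq k 0.
    have z : a0 N 1%N 0 = 0 by have := aZ N 0 0; rewrite !scale0r.
    by rewrite k0 addr0 z subrr subr0 !normr0 expr0n/= mulr0.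
  have [c [h' [hE h'r cc0 cE]]] := scaleE k k0.
  have c2 : 2 * c <= 1 by rewrite cE mulrA ler_pdivrMr// mul1r.
  have -> : F N (v + k) - F N v - a0 N 1%N k = \sum_(j < d0 N) c ^+ j.+2 *: a0 N j.+2 h'.
    rewrite -(a00 N h') {1 2}hE aE !big_ord_recl/= expr0 scale1r expr1 aZ.
    by rewrite (addrC (a0 N 0%N h')) addrK (addrC (c *: _)) addrK.
  apply: (@le_trans _ _ (\sum_(j < d0 N) c ^+ 2 * B * c ^+ j)).
    apply: (le_trans (ler_norm_sum _ _ _)); apply: ler_sum => j _.
    rewrite normrZ normrX (ger0_norm cc0) -add2n exprD -!mulrA.
    do 2! (apply: ler_wpM2l; first exact: cc0).
    rewrite mulrC; apply: ler_wpM2r; first by rewrite exprn_ge0.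
    by apply: aB; rewrite ?h'r// /d !ltnS ltn_ord.
  rewrite -mulr_sumr; apply: (@le_trans _ _ (c ^+ 2 * B * 2)).
    by apply: ler_wpM2l; [rewrite mulr_ge0// exprn_ge0|exact: geometric_sum_le2].
  suff -> : 2 * B / r ^+ 2 * `|k| ^+ 2 = c ^+ 2 * B * 2 by [].
  by rewrite cE; field; rewrite gt_eqF.
pose Ll : {linear E -> V} := HB.pack L (GRing.isLinear.Build _ _ _ _ L Llin).
have Lcont : continuous Ll.
  apply/linear_bounded_continuous/linear_boundedP.
  exists (B / r); split; first by rewrite ger0_real// divr_ge0// ltW.
  move=> M M0 h; apply: (le_trans (LB h)); apply: ler_wpM2r => //; exact: ltW.
have dG : G \o shift v = cst (G v) + Ll +o_ 0 id.
  have D0 : 0 < 1 + 2 * B / r ^+ 2.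
    by rewrite ltr_pwDl// divr_ge0 ?exprn_ge0 ?(ltW r0)// mulr_ge0.
  apply/eqaddoP => e e0; near=> k.
  have kr : 2 * `|k| <= r.
    rewrite -ler_pdivlMl//; near: k; apply: nbhs0_le.
    by rewrite mulr_gt0 ?invr_gt0.
  rewrite /= !fctE /= opprD addrA [k + v]addrC; apply: (le_trans (rem k kr)).
  rewrite expr2 mulrA; apply: ler_wpM2r => //.
  apply: (@le_trans _ _ ((1 + 2 * B / r ^+ 2) * `|k|)).
    by apply: ler_wpM2r => //; rewrite lerDr.
  rewrite -ler_pdivlMl//; near: k; apply: nbhs0_le.
  by rewrite mulr_gt0 ?invr_gt0.
apply/diff_locallyP.
have -> : 'd G v = Ll :> (E -> V) by apply: diff_unique.
by [].
Unshelve. all: by end_near. Qed.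

End UniformLimits.

(** * Limits of complex sequences *)

Section LimitsOfScalars.
Variable C : numFieldType.

Lemma lim_scalar_unique (u : nat -> C) (l m : C) : u @ \oo --> l -> u @ \oo --> m -> l = m.
Proof. exact: cvg_unique. Qed.

(** The order on [C] may be only partial; nonnegativity is read as [l = |l|], which passes to the
    limit. *)
Lemma lim_ge0 (u : nat -> C) l : u @ \oo --> l -> (forall N, 0 <= u N) -> 0 <= l.
Proof.
move=> ul u0; suff -> : l = `|l| by [].
apply: (@cvg_unique _ _ (u @ \oo)) => //.
have -> : u = (fun N => `|u N|) by apply/funext => N; rewrite ger0_norm.
exact: (cvg_norm (ul : u @ \oo --> (l : C^o))).
Qed.

Lemma lim_norm_le (V : normedModType C) (u : nat -> V) (v : nat -> C) l m :
  u @ \oo --> l -> v @ \oo --> m -> (forall N, `|u N| <= v N) -> `|l| <= m.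
Proof.
move=> ul vm uv; rewrite -subr_ge0.
apply: (@lim_ge0 (fun N => v N - `|u N|)) => [|N]; last by rewrite subr_ge0.
by apply: cvgB => //; exact: cvg_norm.
Qed.

Lemma squeeze0 (V : normedModType C) (u : nat -> V) (v : nat -> C) l :
  v @ \oo --> 0 -> (\forall N \near \oo, `|l - u N| <= v N) -> u @ \oo --> l.
Proof.
move=> v0 uv; apply/cvgrPdist_lt => e e0.
have v0e : \forall N \near \oo, `|0 - v N| < e.
  by move/cvgrPdist_lt : (v0 : v @ \oo --> (0 : C^o)); apply.
near=> N; apply: (@le_lt_trans _ _ (v N)); first by near: N.
apply: (@le_lt_trans _ _ `|0 - v N|); last by near: N.
rewrite sub0r normrN ger0_norm//.
by apply: (@le_trans _ _ `|l - u N|) => //; near: N.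
Unshelve. all: by end_near. Qed.

Lemma cvg_of_sqr (V : normedModType C) (u : nat -> V) (v : nat -> C) (l : V) :
  v @ \oo --> 0 -> (forall N, `|l - u N| ^+ 2 <= v N) -> u @ \oo --> l.
Proof.
move=> v0 uv; apply/cvgrPdist_lt => e e0.
have v0e : \forall N \near \oo, `|0 - v N| < e ^+ 2.
  by move/cvgrPdist_lt : (v0 : v @ \oo --> (0 : C^o)); apply; rewrite exprn_gt0.
near=> N; rewrite -(@ltr_pXn2r _ 2)// ?nnegrE ?(ltW e0)//.
apply: (@le_lt_trans _ _ (v N)) => //.
apply: (@le_lt_trans _ _ `|0 - v N|); last by near: N.
rewrite sub0r normrN ger0_norm//.
by apply: le_trans (uv N); rewrite exprn_ge0.
Unshelve. all: by end_near. Qed.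

Lemma cvg_prod_seq (I : Type) (s : seq I) (P : pred I) (u : I -> nat -> C) (l : I -> C) :
  (forall i, u i @ \oo --> l i) ->
  (fun N => \prod_(i <- s | P i) u i N) @ \oo --> \prod_(i <- s | P i) l i.
Proof.
move=> ul; elim: s => [|i s IH].
  by rewrite big_nil; under eq_fun do rewrite big_nil; exact: cvg_cst.
rewrite big_cons; under eq_fun do rewrite big_cons.
by case: ifP => // _; exact: cvgM.
Qed.

(** Factors are exchanged one at a time; the bound by 1 on the product of the [b i] is carried
    through the induction. *)
Lemma prod_dist_le (I : Type) (s : seq I) (a b : I -> C) (e : C) : 0 <= e ->
  (forall i, `|b i| <= 1) -> (forall i, `|a i - b i| <= e) ->
  `|\prod_(i <- s) a i - \prod_(i <- s) b i| <= (1 + e) ^+ size s - 1.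
Proof.
move=> e0 b1 ab.
suff [] : `|\prod_(i <- s) a i - \prod_(i <- s) b i| <= (1 + e) ^+ size s - 1 /\
  `|\prod_(i <- s) b i| <= 1 by [].
have e1 : 0 <= 1 + e by rewrite addr_ge0.
elim: s => [|i s [IH1 IH2]].
  by rewrite !big_nil/= !subrr normr0 normr1.
rewrite !big_cons; set x := \prod_(j <- s) a j in IH1 *; set y := \prod_(j <- s) b j in IH1 IH2 *.
split; last by rewrite normrM mulr_ile1.
have -> : a i * x - b i * y = a i * (x - y) + (a i - b i) * y by ring.
have -> : (1 + e) ^+ size (i :: s) - 1 = (1 + e) * ((1 + e) ^+ size s - 1) + e * 1.
  by rewrite /= exprS; ring.
apply: (le_trans (ler_normD _ _)); rewrite !normrM; apply: lerD; apply: ler_pM => //.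
by rewrite -(subrK (b i) (a i)) addrC (le_trans (ler_normD _ _))// lerD.
Qed.

Lemma cvg_pow_sub1 (t : nat -> C) (k : C) m : t @ \oo --> 0 ->
  (fun N => (1 + t N * k) ^+ m - 1) @ \oo --> 0.
Proof.
move=> t0; rewrite -(subrr (1 : C)) -[X in _ --> X - _](expr1n _ m).
apply: cvgB; last exact: cvg_cst.
have u : (fun N => 1 + t N * k) @ \oo --> (1 : C).
  have := cvgD (cvg_cst (1 : C)) (cvgM t0 (cvg_cst k)); rewrite mul0r addr0; exact.
elim: m => [|m IH]; first by under eq_fun do rewrite expr0; exact: cvg_cst.
by under eq_fun do rewrite exprS; rewrite exprS; exact: cvgM.
Qed.

End LimitsOfScalars.

(** * Remainders of the binomial series *)

Section BinomialTail.
Variables (R : realType) (lambda : R).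
Hypothesis l0 : 0 < lambda.
Local Notation C := R[i].

Definition cbinc k : C := (binc lambda k)%:C%C.
Definition binpow (x : C) : C := cpowR (1 - x) (- lambda).
Definition binsum N (x : C) : C := \sum_(k < N) cbinc k * x ^+ k.
(** For [0 <= r < 1], the coefficients being positive, this single number bounds the remainder on
    the whole disc [|x| <= r]. *)
Definition bintail N (r : C) : C := binpow r - binsum N r.

Lemma cbinc_gt0 k : 0 < cbinc k.
Proof. by rewrite /cbinc (@ltcR R 0) binc_gt0. Qed.

Lemma cbinc_ge0 k : 0 <= cbinc k.
Proof. exact/ltW/cbinc_gt0. Qed.

Lemma cvg_binsum x : `|x| < 1 -> binsum ^~ x @ \oo --> binpow x.
Proof. exact: binomial_series. Qed.

Lemma binsum_le N M (r : C) : 0 <= r -> (N <= M)%N -> binsum N r <= binsum M r.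
Proof.
move=> r0 NM; rewrite /binsum -!(big_mkord predT (fun k => cbinc k * r ^+ k)).
rewrite (big_cat_nat (leq0n N) NM)/= lerDl; apply: sumr_ge0 => k _.
by rewrite mulr_ge0 ?cbinc_ge0// exprn_ge0.
Qed.

Lemma binsum_ge0 N (r : C) : 0 <= r -> 0 <= binsum N r.
Proof.
by move=> r0; apply: sumr_ge0 => k _; rewrite mulr_ge0 ?cbinc_ge0// exprn_ge0.
Qed.

Lemma bintail_cvg0 (r : C) : 0 <= r < 1 -> bintail ^~ r @ \oo --> 0.
Proof.
move=> /andP[r0 r1]; rewrite -(subrr (binpow r)).
by apply: cvgB; [exact: cvg_cst|apply: cvg_binsum; rewrite ger0_norm].
Qed.

Lemma binpow_tail N (x r : C) : `|x| <= r -> r < 1 ->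
  `|binpow x - binsum N x| <= bintail N r.
Proof.
move=> xr r1; have r0 : 0 <= r by exact: le_trans xr.
apply: (@lim_norm_le _ C^o (fun M => binsum (N + M) x - binsum N x)
   (fun M => binsum (N + M) r - binsum N r)).
- apply: cvgB; last exact: cvg_cst.
  have := @cvg_binsum x (le_lt_trans xr r1).
  by rewrite -(cvg_shiftn N); under eq_fun do rewrite addnC.
- apply: cvgB; last exact: cvg_cst.
  have := @cvg_binsum r; rewrite ger0_norm// => /(_ r1).
  by rewrite -(cvg_shiftn N); under eq_fun do rewrite addnC.
- move=> M; rewrite /binsum -!(big_mkord predT (fun k => cbinc k * _ ^+ k)).
  rewrite !(big_cat_nat (leq0n N) (leq_addr M N))/= ![_ + _ - _]addrC !addKr.
  apply: (le_trans (ler_norm_sum _ _ _)); apply: ler_sum => k _.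
  rewrite normrM normrX (ger0_norm (cbinc_ge0 k)); apply: ler_wpM2l; first exact: cbinc_ge0.
  by apply: lerXn2r; rewrite ?nnegrE.
Qed.

Lemma bintail_ge0 N (r : C) : 0 <= r < 1 -> 0 <= bintail N r.
Proof.
move=> /andP[r0 r1]; apply: le_trans (@binpow_tail N r r _ r1) => //.
by rewrite ger0_norm.
Qed.

(* Discrete Fourier coefficients, over the N-th roots of unity, of
   [y |-> (1 - r x (conj y)) ^ (- lambda)] recover the monomials in x. *)
Definition fourier_mean N (w r : C) k (x : C) : C :=
  \sum_(j < N) (N%:R * cbinc k * r ^+ k)^-1 * (w ^+ j) ^+ k * binpow (x * (r * w ^+ j)^*).

(** By orthogonality the terms of degree less than [N] contribute exactly [x ^ k]; the error comes
    from the tail, and the weights have total modulus [1 / (c_k r^k)]. *)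
Lemma fourier_mean_dist N (w r : C) k (x : C) : N.-primitive_root w -> (k < N)%N ->
  0 < r < 1 -> `|x| <= 1 ->
  `|fourier_mean N w r k x - x ^+ k| <= bintail N r / (cbinc k * r ^+ k).
Proof.
move=> wN kN /andP[r0 r1] x1.
have N0 : 0 < N%:R :> C by rewrite ltr0n (leq_ltn_trans (leq0n k) kN).
have wj j : `|w ^+ j| = 1 by rewrite normrX (norm_prim_root wN) expr1n.
have c0 := cbinc_gt0 k; have rk : 0 < r ^+ k by rewrite exprn_gt0.
pose q := (N%:R * cbinc k * r ^+ k)^-1.
have q0 : 0 < q by rewrite invr_gt0 !mulr_gt0.
have rr : r^* = r by apply: conj_Creal; exact: gtr0_real.
have yr j : `|x * (r * w ^+ j)^*| <= r.
  by rewrite normrM norm_conjC normrM wj mulr1 (gtr0_norm r0) ler_piMl// ltW.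
have exact_part : \sum_(j < N) q * (w ^+ j) ^+ k * binsum N (x * (r * w ^+ j)^*) = x ^+ k.
  have -> : x ^+ k = q * (cbinc k * x ^+ k * r ^+ k * N%:R).
    by rewrite /q; field; rewrite !gt_eqF.
  under eq_bigr do rewrite -mulrA; rewrite -mulr_sumr; congr (_ * _).
  under eq_bigr do rewrite /binsum mulr_sumr.
  rewrite exchange_big/= (bigD1 (Ordinal kN))//= [X in _ + X]big1 ?addr0 => [|i ik].
    transitivity (\sum_(j < N) (cbinc k * x ^+ k * r ^+ k) * ((w ^+ j)^* ^+ k * (w ^+ j) ^+ k)).
      by apply: eq_bigr => j _; rewrite conjCM rr !exprMn; ring.
    by rewrite -mulr_sumr prim_root_sum// eqxx.
  transitivity (\sum_(j < N) (cbinc i * x ^+ i * r ^+ i) * ((w ^+ j)^* ^+ i * (w ^+ j) ^+ k)).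
    by apply: eq_bigr => j _; rewrite conjCM rr !exprMn; ring.
  rewrite -mulr_sumr prim_root_sum// ifN ?mulr0//.
  by apply: contra ik => /eqP ki; apply/eqP/val_inj.
rewrite -[in X in `|_ - X|]exact_part /fourier_mean -sumrB.
under eq_bigr do rewrite -mulrBr.
apply: (le_trans (ler_norm_sum _ _ _)).
apply: (@le_trans _ _ (\sum_(j < N) q * bintail N r)).
  apply: ler_sum => j _; rewrite !normrM (gtr0_norm q0) normrX wj expr1n mulr1.
  by apply: ler_wpM2l (binpow_tail _ _ _) => //; exact: ltW.
rewrite sumr_const card_ord -mulr_natl /q.
suff -> : N%:R * ((N%:R * cbinc k * r ^+ k)^-1 * bintail N r) =
    bintail N r / (cbinc k * r ^+ k) by [].
by field; rewrite !gt_eqF.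
Qed.

End BinomialTail.

(** * Hilbert spaces of holomorphic functions *)

Section HolHilbert.
Variables (R : realType) (n : nat) (D : set 'rV[R[i]]_n) (H : holHilbert D).
Local Notation C := R[i].
Implicit Types (f g : H).
Local Notation "''[' f , g ]" := (hdot H f%R g%R) : ring_scope.

Lemma hdotDl f1 f2 g : '[f1 + f2, g] = '[f1, g] + '[f2, g].
Proof. exact: linearDl. Qed.

Lemma hdotBl f1 f2 g : '[f1 - f2, g] = '[f1, g] - '[f2, g].
Proof. exact: linearBl. Qed.

Lemma hdotZl (c : C) f g : '[c *: f, g] = c * '[f, g].
Proof. exact: linearZl_LR. Qed.

Lemma hdotBr f g1 g2 : '[f, g1 - g2] = '[f, g1] - '[f, g2].
Proof. exact: linearBr. Qed.

Lemma hdotZr (c : C) f g : '[f, c *: g] = c^* * '[f, g].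
Proof. exact: linearZr_LR. Qed.

Lemma hdot_suml I (r : seq I) (P : pred I) (F : I -> H) g :
  '[\sum_(i <- r | P i) F i, g] = \sum_(i <- r | P i) '[F i, g].
Proof. exact: linear_sumlz. Qed.

Lemma hdot_sumr I (r : seq I) (P : pred I) (F : I -> H) f :
  '[f, \sum_(i <- r | P i) F i] = \sum_(i <- r | P i) '[f, F i].
Proof. exact: linear_sumr. Qed.

Lemma hdotC f g : '[f, g] = '[g, f]^*.
Proof. by rewrite hermC expr0 mul1r. Qed.

Lemma hdot0l g : '[0, g] = 0.
Proof. exact: linear0l. Qed.

Lemma hdot0r g : '[g, 0] = 0.
Proof. exact: linear0r. Qed.

Lemma hdot_le f g : `|'[f, g]| <= `|f| * `|g|.
Proof.
have [->|g0] := eqVneq g 0; first by rewrite hdot0r !normr0 mulr0.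
have ng : 0 < `|g| by rewrite normr_gt0.
rewrite -(@ler_pXn2r _ 2)// ?nnegrE ?mulr_ge0// exprMn !hnormE.
have gg : 0 < '[g, g] by rewrite -hnormE exprn_gt0.
pose t := '[f, g] / '[g, g].
have ggc : '[g, g]^* = '[g, g] by rewrite -hdotC.
have cV (x : C) : (x^-1)^* = (x^*)^-1 by exact: fmorphV.
have : 0 <= '[f - t *: g, f - t *: g] by rewrite -hnormE exprn_ge0.
rewrite hdotBl !hdotBr !hdotZl !hdotZr (hdotC g f) /t conjCM cV ggc.
have -> : '[f, f] - '[f, g]^* / '[g, g] * '[f, g] -
  ('[f, g] / '[g, g] * '[f, g]^* -
   '[f, g] / '[g, g] * ('[f, g]^* / '[g, g] * '[g, g])) =
  '[f, f] - '[f, g] * '[f, g]^* / '[g, g] by field; rewrite gt_eqF.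
by rewrite -normCK subr_ge0 ler_pdivrMr.
Qed.

Lemma cvg_hdotl (u : nat -> H) f g : u @ \oo --> f ->
  (fun N => '[u N, g]) @ \oo --> '[f, g].
Proof.
move=> uf; apply: (@squeeze0 _ C^o _ (fun N => `|f - u N| * `|g|)); last first.
  by apply: nearW => N; rewrite -hdotBl hdot_le.
rewrite -(mul0r `|g|); apply: cvgM; last exact: cvg_cst.
rewrite -(normr0 H) -(subrr f); apply: cvg_norm; apply: cvgB => //; exact: cvg_cst.
Qed.

Lemma cvg_hdotr (u : nat -> H) f g : u @ \oo --> f ->
  (fun N => '[g, u N]) @ \oo --> '[g, f].
Proof.
move=> uf; apply: (@squeeze0 _ C^o _ (fun N => `|g| * `|f - u N|)); last first.
  by apply: nearW => N; rewrite -hdotBr hdot_le.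
rewrite -(mulr0 `|g|); apply: cvgM; first exact: cvg_cst.
rewrite -(normr0 H) -(subrr f); apply: cvg_norm; apply: cvgB => //; exact: cvg_cst.
Qed.

Lemma hnormB_sqr f g : `|f - g| ^+ 2 = '[f, f] - '[f, g] - '[g, f] + '[g, g].
Proof. rewrite hnormE hdotBl !hdotBr; ring. Qed.

Lemma hilbert_cvg (u : nat -> H) (e : nat -> C) :
  (forall N M, (N <= M)%N -> `|u M - u N| ^+ 2 <= e N) -> e @ \oo --> 0 -> cvgn u.
Proof.
move=> ue e0; apply/cauchy_cvgP/cauchy_ballP => d d0; rewrite !near_map2 -ball_normE /=.
have d2 : 0 < d / 2 by rewrite divr_gt0.
have [N _ NP] : \forall N \near \oo, `|0 - e N| < (d / 2) ^+ 2.
  by move/cvgrPdist_lt : (e0 : e @ \oo --> (0 : C^o)); apply; rewrite exprn_gt0.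
have uN M : (N <= M)%N -> `|u M - u N| < d / 2.
  move=> NM; rewrite -(@ltr_pXn2r _ 2)// ?nnegrE ?(ltW d2)//.
  apply: le_lt_trans (NP N (leqnn N)); rewrite sub0r normrN.
  by rewrite ger0_norm; [exact: ue|apply: le_trans (ue _ _ NM); rewrite exprn_ge0].
near=> i j; rewrite -(subrK (u N) (u i)) -addrA (le_lt_trans (ler_normD _ _))//.
rewrite (splitr d) ltrD//; first by apply: uN; near: i; exact: nbhs_infty_ge.
by rewrite distrC /=; apply: uN; near: j; exact: nbhs_infty_ge.
Unshelve. all: by end_near. Qed.

End HolHilbert.

(** * Monomials in the weighted Bergman space *)

Section Monomials.
Variables (R : realType) (n : nat).
Local Notation C := R[i].

Definition mono (a : 'I_n -> nat) (z : 'rV[C]_n) : C := \prod_i z 0 i ^+ a i.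

Definition nat_index N (J : {ffun 'I_n -> 'I_N}) : 'I_n -> nat := fun i => J i.

(** Multi-indices are truncated to a cube because it is stable under permutations of the coordinates
    and sums of products over it factor into one-variable sums. *)
Definition cube_sum (V : nmodType) N (F : ('I_n -> nat) -> V) : V :=
  \sum_(J : {ffun 'I_n -> 'I_N}) F (nat_index J).

Lemma cube_sum_prod N (F : 'I_n -> nat -> C) :
  cube_sum N (fun a => \prod_i F i (a i)) = \prod_i \sum_(k < N) F i k.
Proof. by rewrite /cube_sum (bigA_distr_bigA (fun i (k : 'I_N) => F i k)). Qed.

Lemma cube_sum_le N M (F : ('I_n -> nat) -> C) : (N <= M)%N -> (forall a, 0 <= F a) ->
  cube_sum N F <= cube_sum M F.
Proof.
move=> NM F0; rewrite /cube_sum.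
pose w (J : {ffun 'I_n -> 'I_N}) : {ffun 'I_n -> 'I_M} := [ffun i => widen_ord NM (J i)].
have wE J : nat_index (w J) = nat_index J by apply/funext => i; rewrite /nat_index ffunE.
have winj : injective w.
  move=> J J' /ffunP JJ'; apply/ffunP => i; apply/val_inj.
  by have := JJ' i; rewrite !ffunE => /(congr1 val).
under eq_bigr do rewrite -wE.
have -> : \sum_J F (nat_index (w J)) = \sum_(J in imset w (mem predT)) F (nat_index J).
  by rewrite big_imset//= => J J' _ _; exact: winj.
rewrite [leRHS](bigID (fun J => J \in imset w (mem predT)))/=.
by rewrite lerDl; apply: sumr_ge0.
Qed.

Lemma cube_sum_perm N (V : nmodType) (F : ('I_n -> nat) -> V) (s : 'S_n) :
  cube_sum N (fun a => F (a \o s)) = cube_sum N F.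
Proof.
rewrite /cube_sum; pose h (J : {ffun 'I_n -> 'I_N}) : {ffun 'I_n -> 'I_N} := [ffun i => J (s i)].
have hinj : injective h.
  move=> J J' /ffunP JJ'; apply/ffunP => i.
  by have := JJ' (s^-1%g i); rewrite !ffunE permKV.
rewrite [RHS](reindex_inj hinj)/=; apply: eq_bigr => J _; congr F.
by apply/funext => i; rewrite /nat_index /= ffunE.
Qed.

Lemma cube_sum_single N (V : nmodType) (F : ('I_n -> nat) -> V) b :
  (forall a, a <> b -> F a = 0) ->
  cube_sum N F = if [forall i, b i < N]%N then F b else 0.
Proof.
move=> Fb; rewrite /cube_sum; case: ifP => [/forallP bN|/negP bN].
  pose J0 : {ffun 'I_n -> 'I_N} := [ffun i => Ordinal (bN i)].
  have J0E : nat_index J0 = b by apply/funext => i; rewrite /nat_index ffunE.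
  rewrite (bigD1 J0)//= J0E big1 ?addr0// => J JJ0; apply: Fb => Jb.
  move/eqP: JJ0; apply; apply/ffunP => i; apply/val_inj.
  by rewrite ffunE /= -Jb.
rewrite big1// => J _; apply: Fb => Jb; apply: bN; apply/forallP => i.
by rewrite -Jb /nat_index.
Qed.

End Monomials.

Section WeightedBergman.
Variables (R : realType) (n : nat) (lambda : R) (A : holHilbert (polydisc R n)).
Hypotheses (l0 : 0 < lambda) (hA : is_weighted_bergman lambda A).
Local Notation C := R[i].
Local Notation D := (polydisc R n).
Local Notation "''[' f , g ]" := (hdot A f%R g%R) : ring_scope.
Implicit Types (f g : A) (a b : 'I_n -> nat).

Definition mcoef a : C := \prod_i cbinc lambda (a i).

Lemma mcoef_gt0 a : 0 < mcoef a.
Proof. by apply: prodr_gt0 => i _; exact: cbinc_gt0. Qed.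

Lemma kernel_vector : exists kv : 'rV[C]_n -> A, forall w, D w ->
  (forall z, D z -> hfun A (kv w) z = \prod_i binpow lambda (z 0 i * (w 0 i)^*)) /\
  (forall f, '[f, kv w] = hfun A f w).
Proof.
have /choice [kv kvP] : forall w, exists k : A, D w ->
  (forall z, D z -> hfun A k z = \prod_i binpow lambda (z 0 i * (w 0 i)^*)) /\
  (forall f, '[f, k] = hfun A f w).
  move=> w; have [Dw|nDw] := pselect (D w); last by exists 0.
  by have [k kP] := hA Dw; exists k.
by exists kv.
Qed.

(** Radius of the torus of sample points; any value strictly between 0 and 1 would do. *)
Local Notation r := (2^-1 : C).
Let r0 : 0 < r. Proof. by rewrite invr_gt0. Qed.
Let r1 : r < 1. Proof. by rewrite invf_lt1 ?ltr1n. Qed.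

Definition rootof (N : nat) : C :=
  xget 1 [set w : C | N.+1.-primitive_root w].

Lemma rootofP N : N.+1.-primitive_root (rootof N).
Proof. exact: (xgetPex 1 (@prim_root_exists C N.+1 isT)). Qed.

Let wt N a (J : {ffun 'I_n -> 'I_N.+1}) : C :=
  \prod_i ((N.+1%:R * cbinc lambda (a i) * r ^+ a i)^-1 * (rootof N ^+ J i) ^+ a i).

Definition sample N (J : {ffun 'I_n -> 'I_N.+1}) : 'rV[C]_n :=
  \row_i (r * rootof N ^+ J i).

Lemma sample_polydisc N (J : {ffun 'I_n -> 'I_N.+1}) : D (sample J).
Proof.
move=> i; rewrite mxE normrM normrX (norm_prim_root (rootofP N)) expr1n mulr1.
by rewrite gtr0_norm.
Qed.

(** This is the pairing of [f] with the combination of kernel vectors at the sample points, of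
    weights [wt], when [phi] is the function of [f]. Accepting any function allows comparison with
    monomials before they are known to lie in the space. *)
Definition fourier_coef N a (phi : 'rV[C]_n -> C) : C :=
  \sum_(J : {ffun 'I_n -> 'I_N.+1}) (wt a J)^* * phi (sample J).

Lemma norm_wt N a (J : {ffun 'I_n -> 'I_N.+1}) :
  `|wt a J| = \prod_(i < n) (N.+1%:R * cbinc lambda (a i) * r ^+ a i)^-1.
Proof.
rewrite /wt normr_prod; apply: eq_bigr => i _.
rewrite normrM !normrX (norm_prim_root (rootofP N)) !expr1n mulr1 gtr0_norm//.
by rewrite invr_gt0 !mulr_gt0 ?cbinc_gt0// exprn_gt0.
Qed.

Definition fourier_norm a : C := \prod_(i < n) (cbinc lambda (a i) * r ^+ a i)^-1.

(** The [(N + 1)^n] sample points cancel the factors [N + 1] of the weights, so the resulting bounds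
    are uniform in [N]. *)
Lemma sum_norm_wt N a : \sum_(J : {ffun 'I_n -> 'I_N.+1}) `|wt a J| = fourier_norm a.
Proof.
under eq_bigr do rewrite norm_wt.
rewrite sumr_const card_ffun !card_ord -[LHS]mulr_natl natrX.
rewrite -[X in _ ^+ X](card_ord n) -prodr_const -big_split/=; apply: eq_bigr => i _.
by field; rewrite ?expf_neq0 ?gt_eqF ?cbinc_gt0 ?ltr0n//.
Qed.

Lemma fourier_coef_dist N a (phi psi : 'rV[C]_n -> C) (e : C) :
  (forall z, D z -> `|phi z - psi z| <= e) ->
  `|fourier_coef N a phi - fourier_coef N a psi| <= fourier_norm a * e.
Proof.
move=> pe; rewrite /fourier_coef -sumrB; apply: (le_trans (ler_norm_sum _ _ _)).
rewrite -(sum_norm_wt N) mulr_suml; apply: ler_sum => J _.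
rewrite -mulrBr normrM norm_conjC; apply: ler_wpM2l => //.
exact/pe/sample_polydisc.
Qed.

Lemma fourier_coef_mono N a b : (forall i, (a i < N.+1)%N) -> (forall i, (b i < N.+1)%N) ->
  fourier_coef N a (mono b) = if a == b then (mcoef a)^-1 else 0.
Proof.
move=> aN bN; have rr : r^* = r by apply: conj_Creal; exact: gtr0_real.
pose F i k := (N.+1%:R * cbinc lambda (a i) * r ^+ a i)^-1 * r ^+ b i *
  ((rootof N ^+ k)^* ^+ a i * (rootof N ^+ k) ^+ b i).
have -> : fourier_coef N a (mono b) = cube_sum N.+1 (fun J => \prod_i F i (J i)).
  apply: eq_bigr => J _; rewrite /wt /mono rmorph_prod -big_split/=.
  apply: eq_bigr => i _; rewrite mxE conjCM conjCX /F /nat_index.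
  rewrite (conj_Creal (x := (_)^-1)); first by rewrite exprMn; ring.
  by rewrite gtr0_real// invr_gt0 !mulr_gt0 ?cbinc_gt0// exprn_gt0.
rewrite cube_sum_prod.
have FE i : \sum_(k < N.+1) F i k =
    (if b i == a i then (cbinc lambda (a i))^-1 else 0).
  rewrite -mulr_sumr (prim_root_sum (rootofP N))//; case: eqP => [->|]; last by rewrite mulr0.
  by field; rewrite ?expf_neq0 ?gt_eqF ?cbinc_gt0 ?ltr0n//.
under eq_bigr do rewrite FE.
case: (eqVneq a b) => [ab|ab].
  rewrite /mcoef -prodfV; apply: eq_bigr => i _; by rewrite ab eqxx.
have [i /eqP abi] : exists i, a i <> b i.
  apply/not_existsP => h; move/eqP: ab; apply; apply/funext => i.
  by have /contrapT := h i.
by rewrite (bigD1 i)//= eq_sym (negbTE abi) mul0r.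
Qed.

Lemma hfunZ (c : C) f z : hfun A (c *: f) z = c * hfun A f z.
Proof. exact: (congr1 (fun phi => phi z) (linearZ_LR (hfun A) c f)). Qed.

Lemma hfun_comb (I : finType) (c : I -> C) (F : I -> A) z :
  hfun A (\sum_i c i *: F i) z = \sum_i c i * hfun A (F i) z.
Proof.
rewrite raddf_sum fct_sumE; apply: eq_bigr => i _.
exact: hfunZ.
Qed.

(** The function of [E N] is uniformly close to [z^a], and [<E M, E N>] is a Fourier coefficient of
    the function of [E M], hence close to [1 / c_a]: in [|E M - E N|^2] the four terms cancel up to
    small errors, and the sequence is Cauchy. The second conclusion expresses [<f, x>] through
    values of [f]; this is how symmetries of functions reach their coefficients. *)
Lemma monomial_vector a : exists x : A,
  (forall z, D z -> hfun A x z = mono a z) /\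
  (forall f, (fun N => fourier_coef N a (hfun A f)) @ \oo --> '[f, x]).
Proof.
have [kv kvP] := kernel_vector.
pose E N : A := \sum_(J : {ffun 'I_n -> 'I_N.+1}) wt a J *: kv (sample J).
have dotE f N : '[f, E N] = fourier_coef N a (hfun A f).
  rewrite hdot_sumr; apply: eq_bigr => J _; rewrite hdotZr.
  by have [_ ->] := kvP _ (sample_polydisc J).
have funE N z : D z -> hfun A (E N) z =
    \prod_i fourier_mean lambda N.+1 (rootof N) r (a i) (z 0 i).
  move=> Dz; rewrite hfun_comb /fourier_mean bigA_distr_bigA/=.
  apply: eq_bigr => J _; have [-> // _] := kvP _ (sample_polydisc J).
  by rewrite /wt -big_split/=; apply: eq_bigr => i _; rewrite mxE.
(* From this index on [a i < N + 1] for every [i], as discrete orthogonality requires. *)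
pose K0 := (\max_i a i)%N.
have aK N i : (K0 <= N)%N -> (a i < N.+1)%N.
  by move=> KN; rewrite ltnS (leq_trans _ KN)//; exact: leq_bigmax.
pose kappa : C := \sum_i (cbinc lambda (a i) * r ^+ a i)^-1.
have q0 i : 0 < (cbinc lambda (a i) * r ^+ a i)^-1.
  by rewrite invr_gt0 mulr_gt0 ?cbinc_gt0// exprn_gt0.
have kappa0 : 0 <= kappa by apply: sumr_ge0 => i _; exact: ltW.
pose tl N := bintail lambda N.+1 r.
have tl0 N : 0 <= tl N by apply: bintail_ge0 => //; rewrite r1 ltW.
pose delta N : C := (1 + tl N * kappa) ^+ n - 1.
have delta_dec N M : (N <= M)%N -> delta M <= delta N.
  move=> NM; rewrite lerD2r; apply: lerXn2r; rewrite ?nnegrE ?addr_ge0 ?mulr_ge0//.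
  rewrite lerD2l; apply: ler_wpM2r => //; rewrite lerD2l lerN2.
  by apply: binsum_le => //; exact: ltW.
have delta_cvg : delta @ \oo --> 0.
  apply: cvg_pow_sub1; have := @bintail_cvg0 R lambda l0 r.
  by rewrite (ltW r0) r1 => /(_ isT); rewrite -(cvg_shiftS).
have Edist N z : (K0 <= N)%N -> D z -> `|hfun A (E N) z - mono a z| <= delta N.
  move=> KN Dz; rewrite funE// /mono /delta.
  have sz : size (index_enum 'I_n) = n by rewrite -sum1_size sum1_card card_ord.
  rewrite -[X in _ <= _ ^+ X - 1]sz.
  apply: prod_dist_le => [|i|i].
  - by rewrite mulr_ge0.
  - by rewrite normrX exprn_ile1// ltW// Dz.
  - apply: (le_trans (fourier_mean_dist l0 (rootofP N) (aK N i KN) _ _)).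
    + by rewrite r0 r1.
    + by rewrite ltW// Dz.
    + apply: ler_wpM2l; [exact: tl0|rewrite /kappa (bigD1 i)//= lerDl].
      by apply: sumr_ge0 => j _; exact: ltW.
have dotEE N M : (K0 <= N)%N -> (K0 <= M)%N ->
    `|'[E M, E N] - (mcoef a)^-1| <= fourier_norm a * delta M.
  move=> KN KM; rewrite dotE.
  have <- : fourier_coef N a (mono a) = (mcoef a)^-1.
    by rewrite fourier_coef_mono ?eqxx// => i; exact: aK.
  by apply: fourier_coef_dist => z Dz; exact: Edist.
have fn0 : 0 <= fourier_norm a by apply: prodr_ge0 => i _; exact: ltW.
have ucvg : cvgn (fun N => E (N + K0)%N).
  apply: (@hilbert_cvg _ _ _ _ _ (fun N => 4 * (fourier_norm a * delta (N + K0)%N))).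
    move=> N M NM; set N' := (N + K0)%N; set M' := (M + K0)%N.
    have KN' : (K0 <= N')%N by exact: leq_addl.
    have KM' : (K0 <= M')%N by exact: leq_addl.
    have NM' : (N' <= M')%N by rewrite leq_add2r.
    rewrite -[leLHS]ger0_norm ?exprn_ge0// hnormB_sqr.
    set m := (mcoef a)^-1.
    have -> : '[E M', E M'] - '[E M', E N'] - '[E N', E M'] + '[E N', E N'] =
      ('[E M', E M'] - m) - ('[E M', E N'] - m) - ('[E N', E M'] - m) + ('[E N', E N'] - m).
      ring.
    have dd : fourier_norm a * delta M' <= fourier_norm a * delta N'.
      by apply: ler_wpM2l => //; exact: delta_dec.
    have -> : 4 * (fourier_norm a * delta N') = fourier_norm a * delta N' +
      fourier_norm a * delta N' + fourier_norm a * delta N' + fourier_norm a * delta N' by ring.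
    apply: (le_trans (ler_normD _ _)); apply: lerD; last exact: dotEE.
    apply: (le_trans (ler_normB _ _)); apply: lerD; last exact: dotEE.
    apply: (le_trans (ler_normB _ _)); apply: lerD; exact: (le_trans (dotEE _ _ _ _) dd).
  rewrite -(mulr0 4) -(mulr0 (fourier_norm a)).
  apply: cvgM; first exact: cvg_cst.
  apply: cvgM; first exact: cvg_cst.
  by rewrite (cvg_shiftn K0).
exists (limn (fun N => E (N + K0)%N)); split => [z Dz|f].
- have [_ <-] := kvP _ Dz.
  apply: (@lim_scalar_unique _ (fun N => '[E (N + K0)%N, kv z])); first exact: cvg_hdotl.
  apply: (@squeeze0 _ C^o _ (fun N => delta (N + K0)%N)); first by rewrite (cvg_shiftn K0).
  apply: nearW => N; have [_ ->] := kvP _ Dz.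
  by rewrite distrC; apply: Edist => //; exact: leq_addl.
- rewrite -(cvg_shiftn K0); under eq_fun do rewrite -dotE.
  exact: cvg_hdotr.
Qed.

End WeightedBergman.

(** * Expansions in the orthogonal family of monomials *)

Section MonomialBasis.
Variables (R : realType) (n : nat) (lambda : R) (A : holHilbert (polydisc R n)).
Hypotheses (l0 : 0 < lambda) (hA : is_weighted_bergman lambda A).
Local Notation C := R[i].
Local Notation D := (polydisc R n).
Local Notation "''[' f , g ]" := (hdot A f%R g%R) : ring_scope.
Implicit Types (f g : A) (a b : 'I_n -> nat) (alpha : ('I_n -> nat) -> C).

Lemma polydisc_perm (s : 'S_n) z : D z -> D (col_perm s z).
Proof. by move=> Dz i; rewrite mxE. Qed.

Lemma fourier_coef_perm N (s : 'S_n) a (phi : 'rV[C]_n -> C) :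
  fourier_coef lambda N (a \o s) phi = fourier_coef lambda N a (fun z => phi (col_perm s z)).
Proof.
pose h (J : {ffun 'I_n -> 'I_N.+1}) : {ffun 'I_n -> 'I_N.+1} := [ffun i => J (s i)].
have hinj : injective h.
  move=> J J' /ffunP JJ'; apply/ffunP => i.
  by have := JJ' (s^-1%g i); rewrite !ffunE permKV.
rewrite /fourier_coef (reindex_inj hinj)/=; apply: eq_bigr => J _; congr (_^* * phi _).
  rewrite [RHS](reindex_inj (@perm_inj _ s))/=; apply: eq_bigr => i _.
  by rewrite ffunE.
by apply/rowP => i; rewrite !mxE ffunE.
Qed.

Lemma monomial_basis : exists x : ('I_n -> nat) -> A,
  (forall a z, D z -> hfun A (x a) z = mono a z) /\
  (forall a f, (fun N => fourier_coef lambda N a (hfun A f)) @ \oo --> '[f, x a]).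
Proof.
have /choice [x xP] := monomial_vector l0 hA.
by exists x; split=> a; have [] := xP a.
Qed.

Variable x : ('I_n -> nat) -> A.
Hypothesis hfun_x : forall a z, D z -> hfun A (x a) z = mono a z.
Hypothesis hdot_x : forall a f,
  (fun N => fourier_coef lambda N a (hfun A f)) @ \oo --> '[f, x a].

Lemma fourier_coef_ext N a (phi psi : 'rV[C]_n -> C) : (forall z, D z -> phi z = psi z) ->
  fourier_coef lambda N a phi = fourier_coef lambda N a psi.
Proof. by move=> pp; apply: eq_bigr => J _; rewrite pp//; exact: sample_polydisc. Qed.

Lemma hdot_x_x a b : '[x b, x a] = if a == b then (mcoef lambda a)^-1 else 0.
Proof.
apply: (@lim_scalar_unique _ (fun N => fourier_coef lambda N a (hfun A (x b)))).
  exact: hdot_x.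
pose K0 := (\max_i (maxn (a i) (b i)))%N.
have K0P i : (maxn (a i) (b i) <= K0)%N.
  exact: (@leq_bigmax _ (fun i => maxn (a i) (b i)) i).
rewrite -(cvg_shiftn K0); apply: cvg_near_cst; apply: nearW => N.
rewrite /= (fourier_coef_ext _ _ (hfun_x b)) fourier_coef_mono//.
  by move=> i; rewrite ltnS (leq_trans _ (leq_addl _ _))// (leq_trans _ (K0P i))// leq_maxl.
by move=> i; rewrite ltnS (leq_trans _ (leq_addl _ _))// (leq_trans _ (K0P i))// leq_maxr.
Qed.

Lemma hdot_x_perm (s : 'S_n) (e : C) f a :
  (forall z, D z -> hfun A f (col_perm s z) = e * hfun A f z) ->
  '[f, x (a \o s)] = e * '[f, x a].
Proof.
move=> fs; apply: (@lim_scalar_unique _ (fun N => fourier_coef lambda N (a \o s) (hfun A f))).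
  exact: hdot_x.
under eq_fun do rewrite fourier_coef_perm (fourier_coef_ext _ _ fs).
have fE N : fourier_coef lambda N a (fun z => e * hfun A f z) =
    e * fourier_coef lambda N a (hfun A f).
  by rewrite /fourier_coef mulr_sumr; apply: eq_bigr => J _; rewrite mulrCA.
under eq_fun do rewrite fE.
by apply: cvgM => //; exact: cvg_cst.
Qed.

(** [c_a] is the inverse of the squared norm of [x a], so a limit of these sums has inner product
    [alpha a] with [x a]. *)
Definition partial_sum N (alpha : ('I_n -> nat) -> C) : A :=
  cube_sum N (fun a => (mcoef lambda a * alpha a) *: x a).

Let mcoefJ a : (mcoef lambda a)^* = mcoef lambda a.
Proof. by apply: conj_Creal; rewrite gtr0_real// mcoef_gt0. Qed.

Lemma hdot_partial_sum_x N alpha b :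
  '[partial_sum N alpha, x b] = if [forall i, b i < N]%N then alpha b else 0.
Proof.
rewrite hdot_suml.
rewrite -/(cube_sum N (fun a => '[(mcoef lambda a * alpha a) *: x a, x b])).
rewrite (@cube_sum_single _ _ _ _ b) => [|a ab].
  by case: ifP => // _; rewrite hdotZl hdot_x_x eqxx mulrAC divff ?mul1r// gt_eqF// mcoef_gt0.
by rewrite hdotZl hdot_x_x ifN ?mulr0//; apply/eqP => ba; apply: ab.
Qed.

Lemma hdot_partial_sum N f alpha :
  '[f, partial_sum N alpha] = cube_sum N (fun a => mcoef lambda a * (alpha a)^* * '[f, x a]).
Proof.
by rewrite hdot_sumr; apply: eq_bigr => J _; rewrite hdotZr conjCM mcoefJ.
Qed.

Lemma hdot_partial_sums N M alpha : (N <= M)%N ->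
  '[partial_sum M alpha, partial_sum N alpha] =
  cube_sum N (fun a => mcoef lambda a * `|alpha a| ^+ 2).
Proof.
move=> NM; rewrite hdot_partial_sum; apply: eq_bigr => J _.
rewrite hdot_partial_sum_x ifT; last first.
  by apply/forallP => i; rewrite /nat_index (leq_trans _ NM).
by rewrite normCK -mulrA [_^* * _]mulrC.
Qed.

Lemma partial_sum_dist_eq N M alpha : (N <= M)%N ->
  `|partial_sum M alpha - partial_sum N alpha| ^+ 2 =
  cube_sum M (fun a => mcoef lambda a * `|alpha a| ^+ 2) -
  cube_sum N (fun a => mcoef lambda a * `|alpha a| ^+ 2).
Proof.
move=> NM; rewrite hnormB_sqr [in X in _ - X + _]hdotC !hdot_partial_sums//.
have -> : (cube_sum N (fun a => mcoef lambda a * `|alpha a| ^+ 2))^* =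
    cube_sum N (fun a => mcoef lambda a * `|alpha a| ^+ 2).
  rewrite /cube_sum conjC_sum; apply: eq_bigr => J _.
  by rewrite conjCM mcoefJ conj_Creal// rpredX// normr_real.
ring.
Qed.

Lemma cube_sum_pow N (t : C) :
  cube_sum N (fun a => mcoef lambda a * \prod_i t ^+ a i) = binsum lambda N t ^+ n.
Proof.
rewrite -[X in _ ^+ X](card_ord n) -prodr_const.
rewrite -(cube_sum_prod N (fun (_ : 'I_n) k => cbinc lambda k * t ^+ k)).
by apply: eq_bigr => J _; rewrite /mcoef -big_split.
Qed.

(** Tail of [sum_a c_a t^|a| = (1 - t)^(- lambda n)] outside the cube; at [t = rho^2] it controls
    the squared norm of the remainder when [alpha a = O(rho^|a|)]. *)
Definition square_tail N (t : C) : C := binpow lambda t ^+ n - binsum lambda N t ^+ n.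

Let binpowX_cvg (t : C) : 0 <= t < 1 ->
  (fun N => binsum lambda N t ^+ n) @ \oo --> binpow lambda t ^+ n.
Proof.
move=> /andP[t0 t1].
rewrite -[X in _ ^+ X](card_ord n) -prodr_const.
under eq_fun do rewrite -[X in _ ^+ X](card_ord n) -prodr_const.
by apply: cvg_prod_seq => _; apply: cvg_binsum; rewrite // ger0_norm.
Qed.

Let binpowX_ge N (t : C) : 0 <= t < 1 -> binsum lambda N t ^+ n <= binpow lambda t ^+ n.
Proof.
move=> t01; have /andP[t0 t1] := t01.
have h : binsum lambda N t <= binpow lambda t by rewrite -subr_ge0 bintail_ge0.
by apply: lerXn2r; rewrite // nnegrE ?binsum_ge0// (le_trans _ h)// binsum_ge0.
Qed.

Lemma square_tail_cvg0 (t : C) : 0 <= t < 1 -> square_tail ^~ t @ \oo --> 0.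
Proof.
move=> t01; rewrite -(subrr (binpow lambda t ^+ n)).
by apply: cvgB; [exact: cvg_cst|exact: binpowX_cvg].
Qed.

Let sqr_prod (B rho : C) a :
  (B * \prod_i rho ^+ a i) ^+ 2 = B ^+ 2 * \prod_i (rho ^+ 2) ^+ a i.
Proof.
rewrite exprMn -prodrXl; congr (_ * _); apply: eq_bigr => i _.
by rewrite -!exprM mulnC.
Qed.

Let term_le (B rho : C) alpha : 0 <= B -> 0 <= rho ->
  (forall a, `|alpha a| <= B * \prod_i rho ^+ a i) ->
  forall a, mcoef lambda a * `|alpha a| ^+ 2 <=
    B ^+ 2 * (mcoef lambda a * \prod_i (rho ^+ 2) ^+ a i).
Proof.
move=> B0 rho0 ab a; rewrite [leRHS]mulrCA; apply: ler_wpM2l; first exact/ltW/mcoef_gt0.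
rewrite -sqr_prod; apply: lerXn2r; rewrite ?nnegrE// mulr_ge0//.
by apply: prodr_ge0 => i _; rewrite exprn_ge0.
Qed.

Lemma partial_sum_dist (B rho : C) alpha N M : 0 <= B -> 0 <= rho < 1 -> (N <= M)%N ->
  (forall a, `|alpha a| <= B * \prod_i rho ^+ a i) ->
  `|partial_sum M alpha - partial_sum N alpha| ^+ 2 <= B ^+ 2 * square_tail N (rho ^+ 2).
Proof.
move=> B0 /andP[rho0 rho1] NM ab; rewrite partial_sum_dist_eq//.
have rr : 0 <= rho ^+ 2 < 1 by rewrite exprn_ge0//= expr_lt1.
apply: (@le_trans _ _ (B ^+ 2 * (binsum lambda M (rho ^+ 2) ^+ n -
  binsum lambda N (rho ^+ 2) ^+ n))).
  rewrite mulrBr -!cube_sum_pow /cube_sum !mulr_sumr.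
  rewrite -subr_ge0.
  set S1 := \sum_J _; set S2 := \sum_J _; set S3 := \sum_J _; set S4 := \sum_J _.
  (* So grouped, the inequality is the monotonicity of [cube_sum] in the cube, for the nonnegative
     family of bound minus term. *)
  have -> : S1 - S2 - (S3 - S4) = (S1 - S3) - (S2 - S4) by ring.
  rewrite /S1 /S2 /S3 /S4 -!sumrB subr_ge0.
  apply: (@cube_sum_le _ _ N M (fun a => B ^+ 2 * (mcoef lambda a * \prod_i (rho ^+ 2) ^+ a i)
     - mcoef lambda a * `|alpha a| ^+ 2)) => // a.
  by rewrite subr_ge0 term_le.
apply: ler_wpM2l; first by rewrite exprn_ge0.
by rewrite lerD2r binpowX_ge.
Qed.

Lemma partial_sum_norm (B rho : C) alpha N : 0 <= B -> 0 <= rho < 1 ->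
  (forall a, `|alpha a| <= B * \prod_i rho ^+ a i) ->
  `|partial_sum N alpha| ^+ 2 <= B ^+ 2 * binpow lambda (rho ^+ 2) ^+ n.
Proof.
move=> B0 /andP[rho0 rho1] ab; rewrite hnormE hdot_partial_sums//.
have rr : 0 <= rho ^+ 2 < 1 by rewrite exprn_ge0//= expr_lt1.
apply: (@le_trans _ _ (B ^+ 2 * binsum lambda N (rho ^+ 2) ^+ n)).
  rewrite -cube_sum_pow /cube_sum mulr_sumr; apply: ler_sum => J _.
  exact: term_le.
by apply: ler_wpM2l; [rewrite exprn_ge0|exact: binpowX_ge].
Qed.

Lemma partial_sum_cvg (B rho : C) alpha : 0 <= B -> 0 <= rho < 1 ->
  (forall a, `|alpha a| <= B * \prod_i rho ^+ a i) -> cvgn (partial_sum ^~ alpha).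
Proof.
move=> B0 r01 ab; apply: (@hilbert_cvg _ _ _ _ _ (fun N => B ^+ 2 * square_tail N (rho ^+ 2))).
  by move=> N M NM; exact: partial_sum_dist.
have /andP[rho0 rho1] := r01.
rewrite -(mulr0 (B ^+ 2)); apply: cvgM; first exact: cvg_cst.
by apply: square_tail_cvg0; rewrite exprn_ge0//= expr_lt1.
Qed.

Lemma hdot_lim_partial_sum alpha g b : partial_sum ^~ alpha @ \oo --> g -> '[g, x b] = alpha b.
Proof.
move=> ag; apply: (@lim_scalar_unique _ (fun N => '[partial_sum N alpha, x b])).
  exact: cvg_hdotl.
pose K0 := (\max_i (b i).+1)%N.
rewrite -(cvg_shiftn K0); apply: cvg_near_cst; apply: nearW => N.
rewrite /= hdot_partial_sum_x ifT//; apply/forallP => i.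
rewrite (leq_trans _ (leq_addl _ _))//; exact: (@leq_bigmax _ (fun i => (b i).+1) i).
Qed.

(** The partial sums with coefficients [conj(w^a)] converge in norm to the kernel vector at [w]:
    their squared distance to it is exactly the product of the [(1 - |w_i|^2)^(- lambda)] minus that
    of the partial binomial sums. *)
Lemma hfun_expansion f w : D w ->
  (fun N => cube_sum N (fun a => mcoef lambda a * mono a w * '[f, x a])) @ \oo --> hfun A f w.
Proof.
move=> Dw; have [kv kvP] := kernel_vector hA; have [kvw dotkv] := kvP w Dw.
pose alpha a := (mono a w)^*.
have SE N : '[f, partial_sum N alpha] = cube_sum N (fun a => mcoef lambda a * mono a w * '[f, x a]).
  by rewrite hdot_partial_sum; apply: eq_bigr => J _; rewrite /alpha conjCK.
under eq_fun do rewrite -SE.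
rewrite -dotkv; apply: cvg_hdotr.
have sqr_w i : w 0 i * (w 0 i)^* = `|w 0 i| ^+ 2 by rewrite normCK.
have prodE N : cube_sum N (fun a => mcoef lambda a * `|alpha a| ^+ 2) =
    \prod_i binsum lambda N (`|w 0 i| ^+ 2).
  rewrite /binsum -(cube_sum_prod N (fun i k => cbinc lambda k * (`|w 0 i| ^+ 2) ^+ k)).
  apply: eq_bigr => J _; rewrite /mcoef big_split/=; congr (_ * _).
  rewrite /alpha norm_conjC /mono normr_prod -prodrXl; apply: eq_bigr => i _.
  by rewrite normrX -!exprM mulnC.
have prodJ N : (\prod_i binsum lambda N (`|w 0 i| ^+ 2))^* =
    \prod_i binsum lambda N (`|w 0 i| ^+ 2).
  apply: conj_Creal; rewrite ger0_real//; apply: prodr_ge0 => i _.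
  by rewrite binsum_ge0// exprn_ge0.
have dot1 N : '[partial_sum N alpha, kv w] = \prod_i binsum lambda N (`|w 0 i| ^+ 2).
  rewrite dotkv -prodE /partial_sum /cube_sum (hfun_comb (A := A)).
  apply: eq_bigr => J _; rewrite hfun_x// -mulrA; congr (_ * _).
  by rewrite /alpha norm_conjC normCK mulrC.
have dist N : `|kv w - partial_sum N alpha| ^+ 2 =
    \prod_i binpow lambda (`|w 0 i| ^+ 2) - \prod_i binsum lambda N (`|w 0 i| ^+ 2).
  rewrite hnormB_sqr (hdotC (kv w) (partial_sum N alpha)) dot1 prodJ.
  rewrite hdot_partial_sums// prodE dotkv kvw//.
  under eq_bigr do rewrite sqr_w.
  ring.
apply: (@cvg_of_sqr _ _ _ (fun N => \prod_i binpow lambda (`|w 0 i| ^+ 2) -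
   \prod_i binsum lambda N (`|w 0 i| ^+ 2))) => [|N]; last by rewrite dist.
rewrite -(subrr (\prod_i binpow lambda (`|w 0 i| ^+ 2))).
apply: cvgB; first exact: cvg_cst.
apply: cvg_prod_seq => i; apply: cvg_binsum => //.
by rewrite ger0_norm ?exprn_ge0// expr_lt1// Dw.
Qed.

Lemma monomials_total f : (forall a, '[f, x a] = 0) -> f = 0.
Proof.
move=> fx; apply: hfun_inj => w Dw.
apply: (@lim_scalar_unique _
  (fun N => cube_sum N (fun a => mcoef lambda a * mono a w * '[f, x a]))).
  exact: hfun_expansion.
apply: cvg_near_cst; apply: nearW => N.
by rewrite /cube_sum big1// => J _; rewrite fx mulr0.
Qed.

End MonomialBasis.

(** * Continuity of roots *)

Section Roots.
Variables (R : realType) (n : nat).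
Local Notation C := R[i].
Local Notation D := (polydisc R n).
Implicit Types (u z : 'rV[C]_n).

Lemma entry_le_norm (v : 'rV[C]_n) i : `|v 0 i| <= `|v|.
Proof.
rewrite [leRHS]mx_normE.
exact: (@le_bigmax _ _ _ _ (fun ij : 'I_1 * 'I_n => `|v ij.1 ij.2|%:nng) (0, i)).
Qed.

(** By Vieta's formulas, the polynomial whose roots are the coordinates of [z] whenever
    [u = symmap z]; coordinate [k] holds [s_(k+1)], whence the exponent [n - (k + 1)]. *)
Definition monic_poly u : {poly C} :=
  'X^n + \sum_(k < n) ((-1) ^+ k.+1 * u 0 k) *: 'X^(n - k.+1).

Lemma coef_monic_poly u (k : 'I_n) : (monic_poly u)`_(n - k.+1) = (-1) ^+ k.+1 * u 0 k.
Proof.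
rewrite /monic_poly coefD coefXn coef_sum (bigD1 k)//= coefZ coefXn eqxx mulr1.
rewrite big1 ?addr0 => [|i ik].
  by rewrite ltn_eqF ?add0r//; have := ltn_ord k; lia.
rewrite coefZ coefXn; case: eqP => [h|]; last by rewrite mulr0.
by move/eqP: ik; case; apply/val_inj => /=; move: h; have := ltn_ord k; have := ltn_ord i; lia.
Qed.

Lemma size_monic_poly_tail u :
  (size (\sum_(k < n) ((-1) ^+ k.+1 * u 0 k) *: 'X^(n - k.+1) : {poly C})%R <= n)%N.
Proof.
apply: (leq_trans (size_sum _ _ _)); apply/bigmax_leqP => k _.
apply: (leq_trans (size_scale_leq _ _)); rewrite size_polyXn; have := ltn_ord k; lia.
Qed.

Lemma size_monic_poly u : size (monic_poly u) = n.+1.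
Proof. by rewrite size_polyDl size_polyXn// ltnS size_monic_poly_tail. Qed.

Lemma monic_polyP u : monic_poly u \is monic.
Proof. by rewrite monicE lead_coefDl ?lead_coefXn// size_polyXn ltnS size_monic_poly_tail. Qed.

Lemma prod_XsubC_symmap z : \prod_(i < n) ('X - (z 0 i)%:P) = monic_poly (symmap z).
Proof.
pose cs := [tuple z 0 i | i < n].
have csE : \prod_(i < n) ('X - (z 0 i)%:P) = \prod_(c <- cs) ('X - c%:P).
  by rewrite big_tuple; apply: eq_bigr => i _; rewrite tnth_mktuple.
have coefk (k : 'I_n.+1) : (\prod_(c <- cs) ('X - c%:P))`_(n - k) =
    (-1) ^+ k * mpoly.meval (fun i => z 0 i) (mpoly.mesym n C k).
  rewrite mpoly.mroots_coeff; congr (_ * _); apply: mpoly.meval_eq => i.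
  by rewrite tnth_mktuple.
apply/polyP => i; rewrite csE; have [ni|] := ltnP n i.
  rewrite !nth_default// ?size_monic_poly// size_prod_XsubC size_tuple//.
rewrite leq_eqVlt => /predU1P[->|ni].
  have := coefk ord0; rewrite subn0 expr0 mul1r mpoly.mesym0E mpoly.meval1 => ->.
  by have := monicP (monic_polyP (symmap z)); rewrite lead_coefE size_monic_poly.
have ki : (n - i.+1 < n)%N by lia.
have -> : i = (n - (Ordinal ki).+1)%N by rewrite /=; lia.
rewrite coef_monic_poly mxE.
have := coefk (lift ord0 (Ordinal ki)); rewrite /= /bump/= add1n.
exact.
Qed.

Lemma monic_poly_symmap u z : monic_poly u = \prod_(i < n) ('X - (z 0 i)%:P) -> symmap z = u.
Proof.
rewrite prod_XsubC_symmap => uz; apply/rowP => k.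
have : (monic_poly (symmap z))`_(n - k.+1) = (monic_poly u)`_(n - k.+1) by rewrite uz.
rewrite !coef_monic_poly => /(mulfI _); apply.
by rewrite expf_neq0// oppr_eq0 oner_eq0.
Qed.

Lemma symmap_surj u : exists z, symmap z = u.
Proof.
have [rs rsE] := closed_field_poly_normal (monic_poly u).
rewrite (monicP (monic_polyP u)) scale1r in rsE.
have srs : size rs = n.
  by apply/eqP; rewrite -eqSS -(size_prod_XsubC rs id) -rsE size_monic_poly.
exists (\row_i rs`_i); apply: monic_poly_symmap; rewrite rsE (big_nth 0) srs big_mkord.
by apply: eq_bigr => i _; rewrite mxE.
Qed.

Lemma horner_monic_poly_prod z (x : C) :
  (monic_poly (symmap z)).[x] = \prod_(i < n) (x - z 0 i).
Proof. by rewrite -prod_XsubC_symmap horner_prod; apply: eq_bigr => i _; rewrite !hornerE. Qed.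

Lemma horner_monic_poly_dist u u' (x : C) :
  (monic_poly u).[x] - (monic_poly u').[x] =
  \sum_(k < n) (-1) ^+ k.+1 * (u 0 k - u' 0 k) * x ^+ (n - k.+1).
Proof.
rewrite /monic_poly !hornerD !horner_sum opprD addrACA subrr add0r -sumrB.
by apply: eq_bigr => k _; rewrite !hornerZ !hornerXn; ring.
Qed.

(* A root x of a perturbed polynomial with |x| > r would satisfy
   |x|^n (1 - r0/r)^n <= |P x| <= rho |x|^n sum_k r^-(k+1), where P is the
   original polynomial, all of whose roots have modulus at most r0 < r. *)
Lemma roots_perturbation z0 (r0 r : C) : 0 <= r0 -> r0 < r -> (forall i, `|z0 0 i| <= r0) ->
  exists2 rho : C, 0 < rho & forall z, (forall k, `|symmap z 0 k - symmap z0 0 k| <= rho) ->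
    forall i, `|z 0 i| <= r.
Proof.
move=> r00 r0r zr0; have r_gt0 : 0 < r by exact: le_lt_trans r0r.
pose q := 1 - r0 / r; have q0 : 0 < q by rewrite subr_gt0 ltr_pdivrMr// mul1r.
pose S := \sum_(k < n) r^-1 ^+ k.+1 : C.
have S0 : 0 <= S by apply: sumr_ge0 => k _; rewrite exprn_ge0// invr_ge0 ltW.
have S1 : 0 < 1 + S by rewrite ltr_pwDl.
exists (q ^+ n / (1 + S)); first by rewrite divr_gt0// exprn_gt0.
move=> z zz0 i; set x := z 0 i.
have : r \is Num.real by rewrite gtr0_real.
move=> /(real_leP (normr_real x))[//|rx]; exfalso.
have x0 : 0 < `|x| by exact: lt_trans rx.
have Px0 : (monic_poly (symmap z)).[x] = 0.
  by rewrite horner_monic_poly_prod (bigD1 i)//= subrr mul0r.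
have low : `|x| ^+ n * q ^+ n <= `|(monic_poly (symmap z0)).[x]|.
  rewrite horner_monic_poly_prod normr_prod -exprMn -[X in _ ^+ X](card_ord n) -prodr_const.
  apply: ler_prod => k _; rewrite mulr_ge0 ?(ltW q0)//=.
  apply: le_trans (lerB_dist _ _); rewrite /q mulrBr mulr1 lerD2l lerN2.
  apply: (le_trans (zr0 k)); rewrite mulrCA ler_peMr// ler_pdivlMr// mul1r; exact: ltW.
have up : `|(monic_poly (symmap z0)).[x]| <= q ^+ n / (1 + S) * S * `|x| ^+ n.
  rewrite -[X in `|X|]subr0 -Px0 horner_monic_poly_dist.
  apply: (le_trans (ler_norm_sum _ _ _)).
  rewrite mulr_sumr mulr_suml; apply: ler_sum => k _.
  rewrite !normrM !normrX normrN normr1 expr1n mul1r -mulrA; apply: ler_pM => //.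
    by rewrite distrC.
  have -> : `|x| ^+ n = `|x| ^+ k.+1 * `|x| ^+ (n - k.+1) by rewrite -exprD subnKC.
  rewrite mulrA ler_peMl ?exprn_ge0// -exprMn exprn_ege1// mulrC ler_pdivlMr// mul1r.
  exact: ltW.
have := le_trans low up; rewrite [leLHS]mulrC ler_pM2r ?exprn_gt0// => h.
have : q ^+ n * (1 + S) <= q ^+ n * S.
  by move: h; rewrite -mulrA [_^-1 * _]mulrC mulrA ler_pdivlMr.
by rewrite ler_pM2l ?exprn_gt0// gerDr ler10.
Qed.

Lemma polydisc_radius z : D z -> exists2 r : C, 0 <= r < 1 & forall i, `|z 0 i| <= r.
Proof.
(* The product of the numbers [1 - |z_i|], all in [(0, 1]], is at most each of them. This takes the
   place of a maximum and covers [n = 0]. *)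
move=> Dz; exists (1 - \prod_i (1 - `|z 0 i|)).
  rewrite subr_ge0 gtrBl prodr_gt0 ?andbT => [|i _]; last by rewrite subr_gt0.
  by apply: prodr_ile1 => i _; rewrite subr_ge0 (ltW (Dz i)) gerBl/=.
move=> i; rewrite lerBrDr addrC -lerBrDr (bigD1 i)//= ler_piMr//.
  by rewrite subr_ge0 ltW.
by apply: prodr_ile1 => j _; rewrite subr_ge0 (ltW (Dz j)) gerBl/=.
Qed.

End Roots.

(** * Symmetric and anti-symmetric polynomials *)

Section LinePolynomials.
Variables (C : comNzRingType).

Lemma meval_horner k (q : mpoly.mpoly k C) (L : 'I_k -> {poly C}) :
  exists Q : {poly C}, forall t, Q.[t] = mpoly.meval (fun i => (L i).[t]) q.
Proof.
exists (\sum_(m <- mpoly.msupp q)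
  mpoly.mcoeff m q *: \prod_i L i ^+ mpoly.fun_of_multinom m i) => t.
rewrite mpoly.mevalE horner_sum; apply: eq_bigr => m _.
rewrite hornerZ horner_prod; congr (_ * _); apply: eq_bigr => i _.
by rewrite horner_exp.
Qed.

(** Only an upper bound on the degree is imposed: [c] may vanish, which makes the notion stable
    under sums and products. *)
Definition top_coef (p : {poly C}) d c := (size p <= d.+1)%N /\ p`_d = c.

Lemma top_coefM (p q : {poly C}) d d' c c' :
  top_coef p d c -> top_coef q d' c' -> top_coef (p * q) (d + d') (c * c').
Proof.
move=> [sp pc] [sq qc]; split.
  by apply: (leq_trans (size_polyMleq _ _)); rewrite -subn1; lia.
have dd : (d < (d + d').+1)%N by rewrite ltnS leq_addr.
rewrite coefM (bigD1 (Ordinal dd))//= pc addKn qc big1 ?addr0// => i id.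
have [di|di] := ltnP d i; first by rewrite (nth_default 0 (leq_trans sp di)) mul0r.
have id' : (i < d)%N.
  by rewrite ltn_neqAle di andbT; apply: contra id => /eqP h; apply/eqP/val_inj.
by rewrite (nth_default 0 (s := q)) ?mulr0//; apply: (leq_trans sq); lia.
Qed.

Lemma top_coef1 : top_coef 1 0 1.
Proof. by split; rewrite ?size_poly1// coef1. Qed.

Lemma top_coefX (p : {poly C}) c m : top_coef p 1 c -> top_coef (p ^+ m) m (c ^+ m).
Proof.
move=> pc; elim: m => [|m IH]; first exact: top_coef1.
by rewrite !exprS -add1n; exact: top_coefM.
Qed.

Lemma top_coef_prod (I : Type) (s : seq I) (p : I -> {poly C}) (d : I -> nat) (c : I -> C) :
  (forall i, top_coef (p i) (d i) (c i)) ->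
  top_coef (\prod_(i <- s) p i) (\sum_(i <- s) d i)%N (\prod_(i <- s) c i).
Proof.
move=> pc; elim: s => [|i s IH]; first by rewrite !big_nil; exact: top_coef1.
by rewrite !big_cons; exact: top_coefM.
Qed.

Lemma top_coef_sum (I : Type) (s : seq I) (p : I -> {poly C}) d (c : I -> C) :
  (forall i, top_coef (p i) d (c i)) ->
  top_coef (\sum_(i <- s) p i) d (\sum_(i <- s) c i).
Proof.
move=> pc; split; last by rewrite coef_sum; apply: eq_bigr => i _; case: (pc i).
by apply: (leq_trans (size_sum _ _ _)); elim: s => [|i s IH];
  rewrite ?big_nil// big_cons geq_max IH andbT; case: (pc i).
Qed.

Lemma top_coefZ (p : {poly C}) d c b : top_coef p d c -> top_coef (b *: p) d (b * c).
Proof.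
by move=> [sp pc]; split; rewrite ?coefZ ?pc// (leq_trans (size_scale_leq _ _)).
Qed.

End LinePolynomials.

Section Alternants.
Variables (R : realType) (n : nat) (e : bool).
Local Notation C := R[i].
Implicit Types (z u : 'rV[C]_n) (a : 'I_n -> nat) (s : 'S_n).

(* Treats both symmetry types at once: e is [false] for symmetric and [true] for
   anti-symmetric functions. *)
Definition symsign s : C := if e then (-1) ^+ (s : bool) else 1.

Definition symmetrization a z : C := \sum_s symsign s * mono a (col_perm s z).

(* The exponent whose symmetrization generates the polynomials of the given
   type over the symmetric ones: a constant or the Vandermonde determinant. *)
Definition base_exponent : 'I_n -> nat := if e then fun i => i else fun=> 0%N.

Lemma symsignM s t : symsign (s * t)%g = symsign s * symsign t.
Proof. by rewrite /symsign; case: e; rewrite ?mulr1// odd_permM signr_addb. Qed.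

Lemma symsignV s : symsign s^-1%g = symsign s.
Proof. by rewrite /symsign; case: e; rewrite // odd_permV. Qed.

Lemma symsign_sqr s : symsign s * symsign s = 1.
Proof. by rewrite /symsign; case: e; rewrite ?mulr1// -expr2 sqrr_sign. Qed.

Lemma norm_symsign s : `|symsign s| = 1.
Proof. by rewrite /symsign; case: e; rewrite ?normr1// normr_sign. Qed.

Lemma symsignJ s : (symsign s)^* = symsign s.
Proof.
by apply: conj_Creal; rewrite /symsign; case: e; rewrite ?real1// rpredX// realN real1.
Qed.

Lemma col_perm_comp s t z : col_perm s (col_perm t z) = col_perm (s * t)%g z.
Proof. by apply/rowP => i; rewrite !mxE permM. Qed.

Lemma mono_perm a s z : mono a (col_perm s z) = mono (a \o (s^-1)%g) z.
Proof.
rewrite /mono (reindex_inj (@perm_inj _ s^-1%g))/=; apply: eq_bigr => i _.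
by rewrite mxE permKV.
Qed.

Lemma symmetrization_perm a t z :
  symmetrization a (col_perm t z) = symsign t * symmetrization a z.
Proof.
rewrite /symmetrization [in LHS](reindex_inj (mulIg t^-1%g))/= mulr_sumr.
apply: eq_bigr => s _; rewrite col_perm_comp mulgKV symsignM symsignV.
by rewrite mulrA [symsign t * _]mulrC.
Qed.

Lemma symmetrization_le a z (rho : C) : (forall i, `|z 0 i| <= rho) ->
  `|symmetrization a z| <= n`!%:R * \prod_i rho ^+ a i.
Proof.
move=> zr; apply: (le_trans (ler_norm_sum _ _ _)).
rewrite mulr_natl -card_Sn -sumr_const.
rewrite [leRHS](eq_bigl predT) => [|s]; last by rewrite inE.
apply: ler_sum => s _; rewrite normrM norm_symsign mul1r normr_prod.
apply: ler_prod => i _; rewrite normr_ge0 normrX mxE/=.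
by apply: lerXn2r; rewrite ?nnegrE// (le_trans _ (zr i)).
Qed.

Lemma symmetrizationZ a (c : C) z :
  symmetrization a (c *: z) = c ^+ (\sum_i a i) * symmetrization a z.
Proof.
rewrite /symmetrization mulr_sumr; apply: eq_bigr => s _; rewrite mulrCA; congr (_ * _).
rewrite /mono -prodrXr -big_split/=; apply: eq_bigr => i _.
by rewrite !mxE exprMn.
Qed.

(** By homogeneity the top coefficient along a line of direction [h] is the value at [h], whatever
    the base point [z]: one direction with nonzero value serves all [z]. *)
Lemma symmetrization_line a z h : exists p : {poly C},
  (forall t, p.[t] = symmetrization a (z + t *: h)) /\
  top_coef p (\sum_i a i)%N (symmetrization a h).
Proof.
pose L i : {poly C} := (z 0 i)%:P + h 0 i *: 'X.
have Lt i : top_coef (L i) 1 (h 0 i).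
  split; last by rewrite coefD coefC coefZ coefX mulr1 add0r.
  apply: (leq_trans (size_polyD _ _)); rewrite geq_max (leq_trans (size_polyC_leq1 _))//.
  by rewrite (leq_trans (size_scale_leq _ _))// size_polyX.
exists (\sum_s symsign s *: \prod_i L (s i) ^+ a i); split.
  move=> t; rewrite horner_sum; apply: eq_bigr => s _; rewrite hornerZ horner_prod.
  congr (_ * _); apply: eq_bigr => i _.
  by rewrite horner_exp hornerD hornerC hornerZ hornerX !mxE [t * _]mulrC.
apply: top_coef_sum => s; apply: top_coefZ.
have -> : mono a (col_perm s h) = \prod_i h 0 (s i) ^+ a i.
  by apply: eq_bigr => i _; rewrite mxE.
by apply: top_coef_prod => i; apply: top_coefX; exact: Lt.
Qed.

Lemma symmap_line z h k : exists p : {poly C}, forall t, p.[t] = symmap (z + t *: h) 0 k.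
Proof.
have [p pE] := meval_horner (mpoly.mesym n C k.+1) (fun i => (z 0 i)%:P + h 0 i *: 'X).
exists p => t; rewrite pE mxE; apply: mpoly.meval_eq => i.
by rewrite hornerD hornerC hornerZ hornerX !mxE [t * _]mulrC.
Qed.

Lemma peval_symmap_line (q : mpoly.mpoly n C) z h :
  exists p : {poly C}, forall t, p.[t] = peval q (symmap (z + t *: h)).
Proof.
have /choice [L LE] := symmap_line z h.
have [p pE] := meval_horner q L.
by exists p => t; rewrite pE; apply: mpoly.meval_eq => i; rewrite LE.
Qed.

Lemma symmetrization_base_neq0 : exists h, symmetrization base_exponent h != 0.
Proof.
rewrite /symmetrization /base_exponent /symsign; case: e.
  exists (\row_i (i : nat)%:R).
  have -> : \sum_(s : 'S_n) (-1) ^+ (s : bool) * mono (fun i : 'I_n => i)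
      (col_perm s (\row_i (i : nat)%:R : 'rV[C]_n)) =
      \det (Vandermonde n (\row_(i < n) (i : nat)%:R : 'rV[C]_n)).
    by apply: eq_bigr => s _; congr (_ * _); apply: eq_bigr => i _; rewrite !mxE.
  rewrite det_Vandermonde; apply/prodf_neq0 => i _; apply/prodf_neq0 => j ij.
  by rewrite !mxE subr_eq0 eqr_nat neq_ltn ij orbT.
exists 0; rewrite (eq_bigr (fun=> 1)) => [|s _].
  rewrite sumr_const; have -> : #|{: 'S_n}| = n`!.
    by rewrite -card_Sn; apply: eq_card => s; rewrite !inE.
  by rewrite pnatr_eq0 -lt0n fact_gt0.
by rewrite mul1r /mono big1// => i _; rewrite expr0.
Qed.

End Alternants.

Section Quotients.
Variables (R : realType) (n : nat).
Local Notation C := R[i].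
Local Notation MP := (mpoly.mpoly n C).

(** [monic_poly] with indeterminate coefficients: remainders modulo it have coefficients polynomial
    in [u], which can then be specialized. *)
Let generic : {poly MP} :=
  'X^n + \sum_(k < n) ((-1) ^+ k.+1 * mpoly.mpolyX C (mpoly.mnm1 k)) *: 'X^(n - k.+1).

Let generic_monic : generic \is monic.
Proof.
rewrite monicE lead_coefDl ?lead_coefXn// size_polyXn ltnS.
apply: (leq_trans (size_sum _ _ _)); apply/bigmax_leqP => k _.
apply: (leq_trans (size_scale_leq _ _)); rewrite size_polyXn; have := ltn_ord k; lia.
Qed.

Let size_generic : size generic = n.+1.
Proof.
rewrite size_polyDl size_polyXn// ltnS.
apply: (leq_trans (size_sum _ _ _)); apply/bigmax_leqP => k _.
apply: (leq_trans (size_scale_leq _ _)); rewrite size_polyXn; have := ltn_ord k; lia.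
Qed.

Let map_generic (u : 'rV[C]_n) :
  map_poly (mpoly.meval (fun i => u 0 i)) generic = monic_poly u.
Proof.
rewrite /generic /monic_poly rmorphD/= map_polyXn; congr (_ + _).
rewrite rmorph_sum/=; apply: eq_bigr => k _.
by rewrite map_polyZ/= map_polyXn rmorphM/= rmorphXn/= rmorphN1 mpoly.mevalXU.
Qed.

(* Reducing the powers of x modulo the monic polynomial with roots z_1, ..., z_n
   factors the generalized Vandermonde matrix [z_j ^ a_i] through the ordinary one. *)
Lemma power_reduction a : exists r : 'I_n -> MP, forall (z : 'rV[C]_n) j,
  z 0 j ^+ a = \sum_(k < n) peval (r k) (symmap z) * z 0 j ^+ k.
Proof.
pose rg : {poly MP} := Pdiv.Ring.rmodp 'X^a generic.
exists (fun k => rg`_k) => z j.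
have /(congr1 (map_poly (mpoly.meval (fun i => symmap z 0 i)))) :=
  Pdiv.RingMonic.rdivp_eq generic_monic 'X^a.
rewrite map_polyXn rmorphD rmorphM/= map_generic => /(congr1 (fun p => p.[z 0 j])).
rewrite hornerXn hornerD hornerM horner_monic_poly_prod (bigD1 j)//= subrr mul0r mulr0 add0r => ->.
rewrite (@horner_coef_wide _ n).
  by apply: eq_bigr => k _; rewrite coef_map.
apply: (leq_trans (size_poly _ _)).
by rewrite -ltnS -size_generic Pdiv.Ring.ltn_rmodpN0// monic_neq0.
Qed.

Lemma antisymmetric_quotient a : exists q : MP, forall z,
  symmetrization true a z = symmetrization true (base_exponent true) z * peval q (symmap z).
Proof.
have /choice [r rE] : forall i, exists r : 'I_n -> MP, forall (z : 'rV[C]_n) j,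
    z 0 j ^+ a i = \sum_(k < n) peval (r k) (symmap z) * z 0 j ^+ k.
  by move=> i; exact: power_reduction.
exists (\det (\matrix_(i, k) r i k)) => z.
have detE b : symmetrization true b z = \det (\matrix_(i < n, j < n) z 0 j ^+ b i).
  by apply: eq_bigr => s _; congr (_ * _); apply: eq_bigr => i _; rewrite !mxE.
rewrite !detE /peval -det_map_mx mulrC -det_mulmx; congr (\det _).
by apply/matrixP => i j; rewrite !mxE rE; apply: eq_bigr => k _; rewrite !mxE.
Qed.

(** The fundamental theorem of symmetric polynomials; the base symmetrization, that of the exponent
    0, is the constant [n!], by which [q] is divided. *)
Lemma symmetric_quotient a : exists q : MP, forall z,
  symmetrization false a z = symmetrization false (base_exponent false) z * peval q (symmap z).
Proof.
pose m : mpoly.multinom n := mpoly.Multinom [tuple a i | i < n].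
pose p : MP := \sum_(s : 'S_n) mpoly.msym s (mpoly.mpolyX C m).
have psym : p \is mpoly.symmetric.
  apply/mpoly.issymP => t; rewrite /p rmorph_sum/=.
  rewrite [RHS](reindex_inj (mulIg t))/=; apply: eq_bigr => s _.
  by rewrite mpoly.msymMm.
have [q [qE _]] := mpoly.sym_fundamental psym.
have n0 : n`!%:R != 0 :> C by rewrite pnatr_eq0 -lt0n fact_gt0.
exists (n`!%:R^-1 *: q) => z.
have -> : symmetrization false (base_exponent false) z = n`!%:R.
  rewrite /symmetrization (eq_bigr (fun=> 1)) => [|s _].
    by rewrite sumr_const -card_Sn; congr (_ *+ _); apply: eq_card => s; rewrite !inE.
  by rewrite mul1r /mono big1// => i _; rewrite expr0.
rewrite /peval mpoly.mevalZ mulrA divff// mul1r.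
have -> : mpoly.meval (fun i => symmap z 0 i) q = mpoly.meval (fun i => z 0 i) p.
  rewrite -qE mpoly.comp_mpoly_meval; apply: mpoly.meval_eq => k.
  by rewrite mxE tnth_mktuple.
rewrite /p rmorph_sum/=; apply: eq_bigr => s _.
rewrite /symsign mul1r mono_perm mpoly.msymX mpoly.mevalX; apply: eq_bigr => i _.
by rewrite !mpoly.mnmE.
Qed.

Lemma symmetrization_quotient e : exists q : ('I_n -> nat) -> MP, forall a z,
  symmetrization e a z = symmetrization e (base_exponent e) z * peval (q a) (symmap z).
Proof.
have /choice [q qE] : forall a, exists q : MP, forall z,
    symmetrization e a z = symmetrization e (base_exponent e) z * peval q (symmap z).
  by move=> a; case: e; [exact: antisymmetric_quotient|exact: symmetric_quotient].
by exists q.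
Qed.

(** [malgrange] on the line [z + t h] bounds [|D(h)| |q_a(s(z))|] by the supremum of
    [|P_a(z + t h)|] over [|t| = 1], hence by [n! rho^|a|], once [h] is scaled so that
    [|h_i| <= rho - r]. The direction is fixed beforehand, so [B] depends neither on [z] nor on
    [a]. *)
Lemma quotient_bound e (q : ('I_n -> nat) -> MP) (r rho : C) :
  (forall a z, symmetrization e a z =
    symmetrization e (base_exponent e) z * peval (q a) (symmap z)) ->
  0 <= r -> r < rho -> exists2 B : C, 0 <= B &
  forall z : 'rV[C]_n, (forall i, `|z 0 i| <= r) ->
  forall a, `|peval (q a) (symmap z)| <= B * \prod_i rho ^+ a i.
Proof.
move=> qE r0 rr; have [h0 h0P] := symmetrization_base_neq0 R n e.
pose S : C := \sum_i `|h0 0 i|.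
have S0 : 0 <= S by apply: sumr_ge0.
have S1 : 0 < 1 + S by rewrite ltr_pwDl.
pose c := (rho - r) / (1 + S).
have c0 : 0 < c by rewrite divr_gt0// subr_gt0.
pose h := c *: h0.
have hP : symmetrization e (base_exponent e) h != 0.
  by rewrite symmetrizationZ mulf_neq0// expf_neq0// gt_eqF.
have hr i : `|h 0 i| <= rho - r.
  rewrite mxE normrM (gtr0_norm c0) /c mulrAC ler_pdivrMr//.
  apply: ler_wpM2l; first by rewrite subr_ge0 ltW.
  by rewrite /S (bigD1 i)//= addrCA lerDl addr_ge0// sumr_ge0.
exists (n`!%:R / `|symmetrization e (base_exponent e) h|); first by rewrite divr_ge0.
move=> z zr a; have [p [pE [sp ptop]]] := symmetrization_line e (base_exponent e) z h.
have [Q QE] := peval_symmap_line (q a) z h.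
have -> : peval (q a) (symmap z) = Q.[0] by rewrite QE scale0r addr0.
rewrite mulrAC ler_pdivlMr ?normr_gt0// mulrC -ptop.
apply: malgrange => // t t1; rewrite pE QE -qE; apply: symmetrization_le => i.
rewrite !mxE (le_trans (ler_normD _ _))// normrM t1 mul1r.
have := lerD (zr i) (hr i); rewrite [h 0 i]mxE addrCA subrr addr0; exact.
Qed.

End Quotients.

(** * Polynomial maps and conjugation *)

Section PolynomialAtProducts.
Variables (C : numClosedFieldType) (E : normedModType C) (v : E).

Lemma polynomial_atM (f g : E -> C^o) : polynomial_at f v -> polynomial_at g v ->
  polynomial_at (fun w => f w * g w : C^o) v.
Proof.
move=> [d [a [a0 aL aE]]] [d' [b [b0 bL bE]]].
pose pa h : {poly C} := \poly_(k < d) a k h; pose pb h : {poly C} := \poly_(k < d') b k h.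
have paE k h : (pa h)`_k = a k h by rewrite coef_poly; case: ltnP => // /a0 ->.
have pbE k h : (pb h)`_k = b k h by rewrite coef_poly; case: ltnP => // /b0 ->.
have hE (F : E -> C^o) D (c : nat -> E -> C^o) :
    (forall h t, F (v + t *: h) = \sum_(k < D) t ^+ k *: c k h) ->
    (forall k h, (D <= k)%N -> c k h = 0) -> forall h, c 0%N h = F v.
  move=> FE c0 h; have := FE h 0; rewrite scale0r addr0 => ->.
  case: D FE c0 => [_ c0|D _ _]; first by rewrite big_ord0 c0.
  rewrite big_ord_recl/= expr0 scale1r big1 ?addr0// => i _.
  by rewrite /bump/= exprS mul0r scale0r.
exists (d + d')%N, (fun k h => (pa h * pb h)`_k : C^o); split.
- move=> k h dk; rewrite nth_default//; apply: (leq_trans (size_polyMleq _ _)).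
  apply: (leq_trans (leq_pred _)).
  exact: (leq_trans (leq_add (size_poly _ _) (size_poly _ _))).
- have c1 h : (pa h * pb h)`_1 = f v * b 1%N h + g v * a 1%N h.
    rewrite coefM !big_ord_recl big_ord0/= /bump/= !paE !pbE (hE f d a)// (hE g d' b)//.
    by rewrite addr0 [a _ _ * _]mulrC.
  move=> c y z; rewrite !c1 aL bL /GRing.scale/=; ring.
- move=> h t; rewrite aE bE.
  have -> : \sum_(k < d) t ^+ k *: a k h = (pa h).[t] :> C.
    by rewrite horner_poly; apply: eq_bigr => k _; rewrite mulrC.
  have -> : \sum_(k < d') t ^+ k *: b k h = (pb h).[t] :> C.
    by rewrite horner_poly; apply: eq_bigr => k _; rewrite mulrC.
  rewrite -hornerM (@horner_coef_wide _ (d + d')).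
    by apply: eq_bigr => k _; rewrite mulrC.
  apply: (leq_trans (size_polyMleq _ _)); apply: (leq_trans (leq_pred _)).
  exact: (leq_add (size_poly _ _) (size_poly _ _)).
Qed.

Lemma polynomial_at_cst (c : C) : polynomial_at (fun _ : E => c : C^o) v.
Proof.
exists 1%N, (fun k _ => if k == 0%N then c else 0 : C^o); split => //.
- by case.
- by move=> b y z; rewrite scaler0 addr0.
- by move=> h t; rewrite big_ord1 expr0 scale1r.
Qed.

Lemma polynomial_at_prod (I : Type) (s : seq I) (f : I -> E -> C^o) :
  (forall i, polynomial_at (f i) v) -> polynomial_at (fun w => \prod_(i <- s) f i w : C^o) v.
Proof.
move=> fP; elim: s => [|i s IH].
  by under eq_fun do rewrite big_nil; exact: polynomial_at_cst.
by under eq_fun do rewrite big_cons; exact: polynomial_atM.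
Qed.

Lemma polynomial_atX (f : E -> C^o) k : polynomial_at f v ->
  polynomial_at (fun w => f w ^+ k : C^o) v.
Proof.
move=> fP; elim: k => [|k IH].
  by under eq_fun do rewrite expr0; exact: polynomial_at_cst.
by under eq_fun do rewrite exprS; exact: polynomial_atM.
Qed.

End PolynomialAtProducts.

Section ConjugatePolynomials.
Variables (R : realType) (n : nat).
Local Notation C := R[i].

Lemma polynomial_at_coord i (v : 'rV[C]_n) : polynomial_at (fun w : 'rV[C]_n => w 0 i : C^o) v.
Proof.
exists 2%N, (fun (k : nat) (h : 'rV[C]_n) =>
  if k == 0%N then v 0 i else if k == 1%N then h 0 i else 0 : C^o); split.
- by case=> [|[]].
- by move=> c y z; rewrite /= !mxE.
- by move=> h t; rewrite !big_ord_recl big_ord0/= addr0 expr0 scale1r !mxE.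
Qed.

(** Conjugating both the argument and the value only conjugates the coefficients, so the result is a
    polynomial in [w]. *)
Lemma peval_conjE (q : mpoly.mpoly n C) (w : 'rV[C]_n) : (peval q (conjv w))^* =
  \sum_(m <- mpoly.msupp q) (\prod_i w 0 i ^+ mpoly.fun_of_multinom m i) * (mpoly.mcoeff m q)^*.
Proof.
rewrite /peval mpoly.mevalE conjC_sum; apply: eq_bigr => m _.
rewrite conjCM mulrC rmorph_prod; congr (_ * _); apply: eq_bigr => i _.
by rewrite mxE -conjCX; exact: conjCK.
Qed.

Lemma polynomial_at_conj (q : mpoly.mpoly n C) (v : 'rV[C]_n) :
  polynomial_at (fun w : 'rV[C]_n => (peval q (conjv w))^* : C^o) v.
Proof.
under eq_fun do rewrite peval_conjE.
apply: (@polynomial_atZ_sum C _ C^o) => m.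
by apply: polynomial_at_prod => i; apply: polynomial_atX; exact: polynomial_at_coord.
Qed.

Lemma conjvK (v : 'rV[C]_n) : conjv (conjv v) = v.
Proof. by apply/rowP => i; rewrite !mxE; exact: conjCK. Qed.

Lemma row_norm_lt (v : 'rV[C]_n) (d : C) : 0 < d -> (forall i, `|v 0 i| < d) -> `|v| < d.
Proof.
move=> d0 vd; change (mx_norm v < d); have [->//|v0] := eqVneq (mx_norm v) 0.
have [[i j] /= ->] := mx_norm_neq0 v0.
by rewrite (ord1 i).
Qed.

Lemma poly_nonroot_near0 (p : {poly C}) (d : C) : p != 0 -> 0 < d ->
  exists2 t, `|t| < d & p.[t] != 0.
Proof.
move=> p0 d0; apply: contrapT => h.
have pt t : `|t| < d -> root p t.
  by move=> td; apply/negPn/negP => nr; apply: h; exists t.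
(* These are [size p] distinct points of the disc, more than [p] can have roots; the denominators
   start at 2 to stay strictly inside. *)
pose s : seq C := [seq d / k.+2%:R | k <- iota 0 (size p)].
have us : uniq s.
  rewrite map_inj_uniq ?iota_uniq// => i j /(mulfI (lt0r_neq0 d0)) /invr_inj /eqP.
  by rewrite eqr_nat => /eqP [].
have := max_poly_roots p0 _ us; rewrite size_map size_iota ltnn => /(_ _)/negP; apply => //.
apply/allP => _ /mapP[k _ ->]; apply: pt.
by rewrite gtr0_norm ?divr_gt0// ltr_pdivrMr// ltr_pMr// ltr1n.
Qed.

End ConjugatePolynomials.

Lemma cvg_horner (C : numFieldType) (p : {poly C}) (t : nat -> C) (l : C) :
  t @ \oo --> l -> (fun N => p.[t N]) @ \oo --> p.[l].
Proof.
move=> tl; elim/poly_ind: p => [|p c IH].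
  by under eq_fun do rewrite horner0; rewrite horner0; exact: cvg_cst.
under eq_fun do rewrite hornerMXaddC; rewrite hornerMXaddC.
by apply: cvgD; [exact: cvgM|exact: cvg_cst].
Qed.

(** * The fibres of the module *)

Section ModuleStructure.
Variables (R : realType) (n : nat) (lambda : R) (A : holHilbert (polydisc R n)).
Hypotheses (l0 : 0 < lambda) (hA : is_weighted_bergman lambda A).
Local Notation C := R[i].
Local Notation D := (polydisc R n).
Local Notation "''[' f , g ]" := (hdot A f%R g%R) : ring_scope.
Variable x : ('I_n -> nat) -> A.
Hypothesis hfun_x : forall a z, D z -> hfun A (x a) z = mono a z.
Hypothesis hdot_x : forall a f,
  (fun N => fourier_coef lambda N a (hfun A f)) @ \oo --> '[f, x a].
Variables (e : bool) (q : ('I_n -> nat) -> mpoly.mpoly n C).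
Hypothesis qE : forall a z,
  symmetrization e a z = symmetrization e (base_exponent e) z * peval (q a) (symmap z).
Implicit Types (f g : A) (a b : 'I_n -> nat) (z u v : 'rV[C]_n) (s : 'S_n).
Local Notation chi := (symsign R e).
Local Notation P := (symmetrization e).
Local Notation delta := (@base_exponent n e).

Definition isotypic f := forall s z, D z -> hfun A f (col_perm s z) = chi s * hfun A f z.

Lemma mcoef_perm a s : mcoef lambda (a \o s) = mcoef lambda a :> C.
Proof. by rewrite /mcoef [RHS](reindex_inj (@perm_inj _ s)). Qed.

Lemma comp_permK a s : (a \o s) \o (s^-1)%g = a.
Proof. by apply/funext => i /=; rewrite permKV. Qed.

Lemma isotypic_hdot f s a : isotypic f -> '[f, x (a \o s)] = chi s * '[f, x a].
Proof. by move=> fM; apply: (hdot_x_perm hdot_x) => z Dz; exact: fM. Qed.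

(** Averaged over [s], this replaces [z^a] by [P_a(z) / n!] in the expansion of an isotypic
    function. *)
Lemma cube_sum_isotypic f N z s : isotypic f ->
  cube_sum N (fun a => mcoef lambda a * (chi s * mono a (col_perm s z)) * '[f, x a]) =
  cube_sum N (fun a => mcoef lambda a * mono a z * '[f, x a]).
Proof.
move=> fM.
rewrite -(cube_sum_perm N
  (fun a => mcoef lambda a * (chi s * mono a (col_perm s z)) * '[f, x a]) s).
apply: eq_bigr => J _; rewrite mcoef_perm mono_perm comp_permK isotypic_hdot//.
rewrite -[in RHS](mul1r (mono _ _)) -(symsign_sqr R e s); ring.
Qed.

Lemma hdot_isotypic f : (forall s a, '[f, x (a \o s)] = chi s * '[f, x a]) -> isotypic f.
Proof.
move=> fx s z Dz; apply: (@lim_scalar_unique _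
  (fun N => cube_sum N (fun a => mcoef lambda a * mono a (col_perm s z) * '[f, x a]))).
  exact: (hfun_expansion l0 hA hfun_x hdot_x (polydisc_perm s Dz)).
have sE N : cube_sum N (fun a => mcoef lambda a * mono a (col_perm s z) * '[f, x a]) =
    chi s * cube_sum N (fun a => mcoef lambda a * mono a z * '[f, x a]).
  rewrite -(cube_sum_perm N (fun a => mcoef lambda a * mono a (col_perm s z) * '[f, x a]) s).
  rewrite [RHS]mulr_sumr; apply: eq_bigr => J _.
  by rewrite mcoef_perm mono_perm comp_permK fx mulrCA.
under eq_fun do rewrite sE.
apply: cvgM; first exact: cvg_cst.
exact: (hfun_expansion l0 hA hfun_x hdot_x Dz).
Qed.

Definition symvec a : A := \sum_s chi s *: x (a \o (s^-1)%g).

Lemma hfun_symvec a z : D z -> hfun A (symvec a) z = P a z.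
Proof.
move=> Dz; rewrite (hfun_comb (A := A)); apply: eq_bigr => s _.
by rewrite hfun_x// mono_perm.
Qed.

Lemma symvec_isotypic a : isotypic (symvec a).
Proof.
move=> s z Dz; rewrite !hfun_symvec//; last exact: polydisc_perm.
exact: symmetrization_perm.
Qed.

Lemma hdot_symvec f a : isotypic f -> '[f, symvec a] = n`!%:R * '[f, x a].
Proof.
move=> fM; rewrite hdot_sumr (eq_bigr (fun=> '[f, x a])) => [|s _].
  by rewrite sumr_const mulr_natl -card_Sn; congr (_ *+ _); apply: eq_card => s; rewrite !inE.
by rewrite hdotZr symsignJ isotypic_hdot// symsignV mulrA symsign_sqr mul1r.
Qed.

(** On a line where the base polynomial is not identically zero it cancels in the ring of
    one-variable polynomials, which gives the equality at [t = 0] even if it vanishes there. The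
    family [q] being arbitrary, its behaviour under permutations must come from this uniqueness. *)
Lemma quotient_unique (p1 p2 : mpoly.mpoly n C) :
  (forall z, P delta z * peval p1 (symmap z) = P delta z * peval p2 (symmap z)) ->
  forall u, peval p1 u = peval p2 u.
Proof.
move=> pp u; have [z <-] := symmap_surj u.
have [h hP] := symmetrization_base_neq0 R n e.
have [p0 [p0E [_ p0top]]] := symmetrization_line e delta z h.
have [r1 r1E] := peval_symmap_line p1 z h; have [r2 r2E] := peval_symmap_line p2 z h.
have p0n : p0 != 0 by apply: contraNneq hP => p00; rewrite -p0top p00 coef0.
have : p0 * (r1 - r2) = 0.
  apply/eqP/negPn/negP => /poly_nonroot_near0 /(_ ltr01)[t _].
  by rewrite hornerM hornerD hornerN p0E r1E r2E mulrBr pp subrr eqxx.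
move=> /eqP; rewrite mulf_eq0 (negbTE p0n)/= subr_eq0 => /eqP r12.
by have := r1E 0; rewrite r12 r2E scale0r addr0.
Qed.

Lemma quotient_perm a s u : peval (q (a \o s)) u = chi s * peval (q a) u.
Proof.
rewrite /peval -mpoly.mevalZ; apply: quotient_unique => z.
rewrite -qE /peval mpoly.mevalZ mulrCA -[mpoly.meval _ _]/(peval _ _) -qE.
rewrite /symmetrization [LHS](reindex_inj (mulgI s))/= mulr_sumr.
apply: eq_bigr => t _; rewrite symsignM -mulrA !mono_perm; congr (_ * (_ * mono _ _)).
by apply/funext => i /=; rewrite invMg permM permKV.
Qed.

(** Forced by the normalization [<D, gamma(v)> = 1]: then [<gamma(v), P_a> = conj(q_a(conj v))], and
    the pairing of an isotypic vector with [P_a] is [n!] times its pairing with [z^a]. *)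
Definition eval_coef v a : C := n`!%:R^-1 * (peval (q a) (conjv v))^*.

(* The generator of the fibre: the vector representing [g |-> (g / D)(z)], where
   D is the base polynomial and [symmap z = conjv v]. *)
Definition eval_vec v : A := limn (fun N => partial_sum lambda x N (eval_coef v)).

Let fact_neq0 : n`!%:R != 0 :> C.
Proof. by rewrite pnatr_eq0 -lt0n fact_gt0. Qed.

Section OneFibre.
Variables (v z : 'rV[C]_n).
Hypothesis cv : cvgn (fun N => partial_sum lambda x N (eval_coef v)).

Lemma hdot_eval_vec_x a : '[eval_vec v, x a] = eval_coef v a.
Proof. exact: (hdot_lim_partial_sum l0 hfun_x hdot_x a cv). Qed.

Lemma eval_vec_isotypic : isotypic (eval_vec v).
Proof.
apply: hdot_isotypic => s a; rewrite !hdot_eval_vec_x /eval_coef quotient_perm.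
by rewrite conjCM symsignJ mulrCA.
Qed.

(** In [D(z) <g, gamma(v)>] the product [D(z) q_a(s(z))] is [P_a(z)], and averaging the expansion of
    [g] over the permutations of [z] gives the same series. The factor [D(z)] stays on the left
    because it may vanish. *)
Lemma hdot_eval_vec g : isotypic g -> D z -> symmap z = conjv v ->
  P delta z * '[g, eval_vec v] = hfun A g z.
Proof.
move=> gM Dz zv; apply: (@lim_scalar_unique _
  (fun N => P delta z * '[g, partial_sum lambda x N (eval_coef v)])).
  by apply: cvgM; [exact: cvg_cst|exact: cvg_hdotr].
have sE N : P delta z * '[g, partial_sum lambda x N (eval_coef v)] =
    cube_sum N (fun a => mcoef lambda a * mono a z * '[g, x a]).
  rewrite (hdot_partial_sum l0).
  transitivity (n`!%:R^-1 * \sum_s cube_sum N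
     (fun a => mcoef lambda a * (chi s * mono a (col_perm s z)) * '[g, x a])).
    rewrite exchange_big/= !mulr_sumr; apply: eq_bigr => J _.
    rewrite -mulr_suml -mulr_sumr -/(P (nat_index J) z) (qE (nat_index J) z) /eval_coef conjCM -zv.
    have -> : (n`!%:R^-1 : C)^* = n`!%:R^-1 by apply: conj_Creal; rewrite realV realn.
    have -> : (peval (q (nat_index J)) (symmap z))^*^* = peval (q (nat_index J)) (symmap z).
      exact: conjCK.
    ring.
  rewrite (eq_bigr _ (fun s _ => cube_sum_isotypic N z s gM)) sumr_const.
  have -> : #|{: 'S_n}| = n`! by rewrite -card_Sn; apply: eq_card => s; rewrite !inE.
  by rewrite -[X in _ * X]mulr_natl mulrA mulVf// mul1r.
under eq_fun do rewrite sE.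
exact: (hfun_expansion l0 hA hfun_x hdot_x Dz).
Qed.

End OneFibre.

Section Neighbourhood.
Variables (Om : set 'rV[C]_n) (B rho : C).
Hypotheses (Om_open : open Om) (B0 : 0 <= B) (rho01 : 0 <= rho < 1).
Hypothesis Om_symmap : forall v, Om v -> exists2 z, D z & symmap z = conjv v.
Hypothesis Om_bound : forall v, Om v -> forall a, `|eval_coef v a| <= B * \prod_i rho ^+ a i.

Let F N v := partial_sum lambda x N (eval_coef v).

Let F_cvg v : Om v -> F ^~ v @ \oo --> eval_vec v.
Proof. by move=> Ov; apply: (partial_sum_cvg l0 hfun_x hdot_x B0 rho01); exact: Om_bound. Qed.

Let F_polynomial N v : polynomial_at (F N) v.
Proof.
rewrite /F /partial_sum /cube_sum; apply: polynomial_atZ_sum => J.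
apply: polynomial_atM; first exact: polynomial_at_cst.
apply: polynomial_atM; first exact: polynomial_at_cst.
exact: polynomial_at_conj.
Qed.

Let rho2 : 0 <= rho ^+ 2 < 1.
Proof. by have /andP[h0 h1] := rho01; rewrite exprn_ge0//= expr_lt1. Qed.

Lemma eval_vec_differentiable v : Om v -> differentiable eval_vec v.
Proof.
move=> Ov; have [d /= d0 dP] : nbhs_ball v Om by apply/nbhs_ballP; exact: open_nbhs_nbhs.
have Oh h : `|h| <= d / 2 -> Om (v + h).
  move=> hd; apply: dP; rewrite -ball_normE /ball_/= opprD addrA subrr add0r normrN.
  by rewrite (le_lt_trans hd)// ltr_pdivrMr// ltr_pMr// ltr1n.
pose K := B ^+ 2 * binpow lambda (rho ^+ 2) ^+ n.
have FK N w : Om w -> `|F N w| ^+ 2 <= K.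
  by move=> Ow; apply: (partial_sum_norm l0 hfun_x hdot_x N B0 rho01); exact: Om_bound.
have K0 : 0 <= K by apply: le_trans (FK 0%N v Ov); rewrite exprn_ge0.
apply: (@uniform_limit_differentiable _ _ _ F eval_vec v (d / 2) (sqrtC K)).
- by rewrite divr_gt0.
- by move=> N; exact: F_polynomial.
- move=> N h hd; rewrite -(@ler_pXn2r _ 2)// ?nnegrE ?sqrtC_ge0// sqrtCK.
  exact/FK/Oh.
- move=> eps eps0; pose T N := B ^+ 2 * square_tail n lambda N (rho ^+ 2).
  have T0 : T @ \oo --> (0 : C^o).
    rewrite -(mulr0 (B ^+ 2)); apply: cvgM; first exact: cvg_cst.
    exact: square_tail_cvg0.
  have e2 : 0 < eps / 2 by rewrite divr_gt0.
  have [N0 _ N0P] : \forall N \near \oo, `|0 - T N| < (eps / 2) ^+ 2.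
    by move/cvgrPdist_lt : T0; apply; rewrite exprn_gt0.
  have FN i w : (N0 <= i)%N -> Om w -> `|F i w - F N0 w| <= eps / 2.
    move=> Ni Ow; rewrite -(@ler_pXn2r _ 2)// ?nnegrE ?(ltW e2)//.
    have h := partial_sum_dist l0 hfun_x hdot_x B0 rho01 Ni (Om_bound Ow).
    apply: (le_trans h); apply: le_trans (ltW (N0P N0 (leqnn N0))).
    by rewrite sub0r normrN ger0_norm// (le_trans _ h)// exprn_ge0.
  exists N0 => i j Ni Nj h hd; rewrite -(subrK (F N0 (v + h)) (F i (v + h))) -addrA.
  apply: (le_trans (ler_normD _ _)); rewrite (splitr eps); apply: lerD.
    by apply: FN => //; exact: Oh.
  by rewrite distrC; apply: FN => //; exact: Oh.
- by move=> h hd; apply: F_cvg; exact: Oh.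
Qed.

(* Extends by continuity, to the zeros of the base polynomial, the identities
   obtained by dividing by it. *)
Lemma generic_approximation v z : Om v -> D z -> symmap z = conjv v ->
  exists zN : nat -> 'rV[C]_n,
    [/\ forall N, D (zN N), forall N, P delta (zN N) != 0,
        (fun N => conjv (symmap (zN N))) @ \oo --> v &
        forall p : mpoly.mpoly n C,
          (fun N => peval p (symmap (zN N))) @ \oo --> peval p (conjv v)].
Proof.
move=> Ov Dz zv; have [r /andP[r0 r1] zr] := polydisc_radius Dz.
have [h hP] := symmetrization_base_neq0 R n e.
have [p0 [p0E [_ p0top]]] := symmetrization_line e delta z h.
have p0n : p0 != 0 by apply: contraNneq hP => p00; rewrite -p0top p00 coef0.
pose S : C := \sum_i `|h 0 i|.
have S0 : 0 <= S by apply: sumr_ge0.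
have S1 : 0 < 1 + S by rewrite ltr_pwDl.
(* A displacement [t h] with [|t|] below this bound keeps every coordinate of modulus less than
   1. *)
have eps0 : 0 < (1 - r) / (1 + S) by rewrite divr_gt0// subr_gt0.
have /choice [t tP] : forall N, exists t : C, `|t| < (1 - r) / (1 + S) / N.+1%:R /\ p0.[t] != 0.
  by move=> N; have [//||t t1 t2] := @poly_nonroot_near0 R p0 ((1 - r) / (1 + S) / N.+1%:R);
    [rewrite divr_gt0|exists t].
have tS N : `|t N| < (1 - r) / (1 + S).
  have [h1 _] := tP N; apply: (lt_le_trans h1).
  by rewrite ler_pdivrMr// ler_peMr ?(ltW eps0)// ler1n.
have t0 : t @ \oo --> (0 : C).
  apply: (@squeeze0 _ C^o t (fun N => (1 - r) / (1 + S) * N.+1%:R^-1)); last first.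
    by apply: nearW => N; have [h1 _] := tP N; rewrite sub0r normrN ltW.
  rewrite -(mulr0 ((1 - r) / (1 + S))); apply: cvgM; first exact: cvg_cst.
  have E N : N.+1%:R^-1 = ((N.+1%:R^-1 : R)%:C)%C :> C by rewrite fmorphV rmorph_nat.
  under eq_fun do rewrite E; apply: cvg_complex => /=; last exact: cvg_cst.
  exact: cvg_harmonic.
have pt (p : {poly C}) : (fun N => p.[t N]) @ \oo --> p.[0].
  exact: cvg_horner.
exists (fun N => z + t N *: h); split.
- move=> N i; rewrite !mxE (le_lt_trans (ler_normD _ _))// normrM.
  have h1 : `|t N| * `|h 0 i| <= `|t N| * S.
    by apply: ler_wpM2l => //; rewrite /S (bigD1 i)//= lerDl sumr_ge0.
  have h2 : `|t N| * S < 1 - r.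
    rewrite -[ltRHS](divfK (x := 1 + S)) ?gt_eqF//.
    apply: (@le_lt_trans _ _ (`|t N| * (1 + S))); first by apply: ler_wpM2l => //; rewrite lerDr.
    by rewrite ltr_pM2r.
  have := ler_ltD (zr i) (le_lt_trans h1 h2); rewrite addrCA subrr addr0; exact.
- by move=> N; have [_] := tP N; rewrite p0E.
- apply/cvgrPdist_lt => d d0.
  have : \forall N \near \oo, forall i, `|symmap z 0 i - symmap (z + t N *: h) 0 i| < d.
    apply: filter_forall => i; have [p pE] := symmap_line z h i.
    have /cvgrPdist_lt /(_ d d0) : (fun N => p.[t N]) @ \oo --> (p.[0] : C^o) := pt p.
    by rewrite pE scale0r addr0; apply: filterS => N; rewrite pE.
  apply: filterS => N Nd; apply: row_norm_lt => // i.
  have -> : (v - conjv (symmap (z + t N *: h))) 0 i = (symmap z 0 i - symmap (z + t N *: h) 0 i)^*.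
    rewrite zv !mxE [RHS]rmorphB /=; congr (_ - _); symmetry; exact: conjCK.
  by rewrite norm_conjC.
- move=> p; have [p' p'E] := peval_symmap_line p z h.
  have := pt p'; rewrite p'E scale0r addr0 zv.
  by under eq_fun do rewrite p'E.
Qed.

Lemma eval_vec_fibre v : Om v -> eval_vec v != 0 /\
  [set f | exists c : C, f = c *: eval_vec v] = tensor_point isotypic (conjv v).
Proof.
move=> Ov; have [z Dz zv] := Om_symmap Ov.
have [zN [zND zNP zNv zNq]] := generic_approximation Ov Dz zv.
have Om_cvg w : Om w -> cvgn (fun N => partial_sum lambda x N (eval_coef w)).
  by move=> Ow; exact: (cvgP _ (F_cvg Ow)).
have gcvg : (fun N => eval_vec (conjv (symmap (zN N)))) @ \oo --> eval_vec v.
  apply: (@cvg_comp _ _ _ (fun N => conjv (symmap (zN N))) eval_vec _ _ _ zNv).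
  exact: (differentiable_continuous (eval_vec_differentiable Ov)).
have OmN : \forall N \near \oo, Om (conjv (symmap (zN N))).
  by apply: zNv; exact: open_nbhs_nbhs.
have dotN g N : isotypic g -> Om (conjv (symmap (zN N))) ->
    '[g, eval_vec (conjv (symmap (zN N)))] = hfun A g (zN N) / P delta (zN N).
  move=> gM ON; apply: (mulfI (zNP N)); rewrite mulrCA mulfV// mulr1.
  exact: (hdot_eval_vec (Om_cvg _ ON) gM (zND N) (esym (conjvK _))).
(* At nearby generic points the pairing is [D / D]; continuity of the generator gives the limit. *)
have base1 : '[symvec delta, eval_vec v] = 1.
  apply: (@lim_scalar_unique _ (fun N => '[symvec delta, eval_vec (conjv (symmap (zN N)))])).
    exact: cvg_hdotr.
  apply: cvg_near_cst; near=> N.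
  rewrite dotN ?hfun_symvec ?divff//; first exact: symvec_isotypic.
  by near: N.
(* At generic points the pairing carries the factor [p(s(zN)) - p(conj v)], which tends to 0. *)
have orth g : shifted_multiples isotypic (conjv v) g -> '[g, eval_vec v] = 0.
  move=> [gM [p [f [fM gE]]]].
  apply: (@lim_scalar_unique _ (fun N => '[g, eval_vec (conjv (symmap (zN N)))])).
    exact: cvg_hdotr.
  have c0 : (fun N => (peval p (symmap (zN N)) - peval p (conjv v)) *
      '[f, eval_vec (conjv (symmap (zN N)))]) @ \oo --> (0 : C).
    rewrite -(mul0r '[f, eval_vec v]) -(subrr (peval p (conjv v))).
    apply: cvgM; last exact: cvg_hdotr.
    by apply: cvgB; [exact: zNq|exact: cvg_cst].
  apply: cvg_trans c0; apply: near_eq_cvg; near=> N.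
  by rewrite !dotN ?gE ?mulrA//; near: N.
split.
  by apply: contra_eqN base1 => /eqP ->; rewrite hdot0r eq_sym oner_eq0.
apply/seteqP; split => [f [c ->]|f [fM fo]].
  split.
    move=> s w Dw; rewrite !hfunZ mulrCA; congr (_ * _).
    by apply: eval_vec_isotypic => //; exact: Om_cvg.
  (* The orthogonal of the generator is a closed subspace containing the shifted multiples, so it
     contains the smallest one. *)
  move=> g gS; suff : [set g | '[g, eval_vec v] = 0] g.
    by move=> /= g0; rewrite hdotZl hdotC g0 conjC0 mulr0.
  apply: gS; split; last by move=> g' /orth.
  split.
  - move=> h hcl; apply/eqP; rewrite -normr_le0; apply/ler_addgt0Pr => d d0.
    have nb : 0 < d / (1 + `|eval_vec v|) by rewrite divr_gt0// ltr_pwDl.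
    have [h' [/= h'0 hh']] := hcl _ (nbhsx_ballx h (d / (1 + `|eval_vec v|)) nb).
    rewrite add0r -(subrK h' h) hdotDl h'0 addr0 (le_trans (hdot_le _ _))//.
    move: hh'; rewrite -ball_normE /ball_/= => /ltW hh'.
    apply: (@le_trans _ _ (d / (1 + `|eval_vec v|) * (1 + `|eval_vec v|))).
      by apply: ler_pM => //; rewrite lerDr.
    by rewrite divfK// gt_eqF// ltr_pwDl.
  - exact: hdot0l.
  - by move=> c' g1 g2 /= g10 g20; rewrite hdotDl hdotZl g10 g20 mulr0 addr0.
exists '[f, symvec delta]; apply/eqP; rewrite -subr_eq0; apply/eqP.
apply: (monomials_total l0 hA hfun_x hdot_x) => a.
rewrite hdotBl hdotZl hdot_eval_vec_x; last exact: Om_cvg.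
(* With [u = conj v], [P_a - q_a(u) D = (q_a o s - q_a(u)) D] is a shifted multiple; orthogonality
   to it expresses every coefficient of [f] through [<f, D>]. *)
pose g := symvec a - peval (q a) (conjv v) *: symvec delta.
have gS : shifted_multiples isotypic (conjv v) g.
  have gE w : hfun A g w = hfun A (symvec a) w - peval (q a) (conjv v) * hfun A (symvec delta) w.
    by rewrite raddfB /= -[LHS]/(hfun A (symvec a) w - hfun A (_ *: _) w) hfunZ.
  split.
    by move=> s w Dw; rewrite !gE !symvec_isotypic// mulrBr mulrCA.
  exists (q a), (symvec delta); split; first exact: symvec_isotypic.
  by move=> w Dw; rewrite gE !hfun_symvec// (qE a w) mulrBl; congr (_ - _); exact: mulrC.
have := fo g (sub_gen_smallest gS).
rewrite hdotBr hdotZr (hdot_symvec a fM) => /eqP; rewrite subr_eq0 => /eqP h.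
apply/eqP; rewrite subr_eq0; apply/eqP/(mulfI fact_neq0); rewrite h /eval_coef.
by rewrite mulrCA mulVKf// mulrC.
Unshelve. all: by end_near. Qed.

End Neighbourhood.

End ModuleStructure.

Lemma isotypic_locally_free (R : realType) (n : nat) (lambda : R)
    (A : holHilbert (polydisc R n)) (e : bool) :
  0 < lambda -> is_weighted_bergman lambda A ->
  locally_free (isotypic (A := A) e) 1 (sympolydisc R n).
Proof.
move=> l0 hA w [z0 Dz0 zw].
have [x [hfun_x hdot_x]] := monomial_basis l0 hA.
have [q qE] := symmetrization_quotient R n e.
have [r0 /andP[r00 r01] zr0] := polydisc_radius Dz0.
have between (a b : R[i]) : a < b -> exists2 c, a < c & c < b.
  by move=> ab; exists ((a + b) / 2); rewrite !midf_lt.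
(* Three radii [r0 < r < rho < 1]: for one preimage of the centre, for preimages over the whole
   neighbourhood, and for the geometric decay of the coefficients. *)
have [r r0r r1] := between _ _ r01; have [rho rrho rho1] := between _ _ r1.
have r_ge0 : 0 <= r by exact/ltW/(le_lt_trans r00).
have rho01 : 0 <= rho < 1 by rewrite rho1 andbT (le_trans r_ge0)// ltW.
have [d d0 dP] := roots_perturbation r00 r0r zr0.
have [B B0 BP] := quotient_bound qE r_ge0 rrho.
pose B' := B / n`!%:R.
have B'0 : 0 <= B' by rewrite divr_ge0.
have Om_root v : ball w d v -> exists2 z : 'rV_n, (forall i, `|z 0 i| <= r) & symmap z = conjv v.
  move=> wv; have [z zv] := symmap_surj (conjv v); exists z => //.
  apply: dP => k; rewrite zv zw !mxE.
  have -> : (v 0 k)^* - (w 0 k)^* = - ((w - v) 0 k)^*.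
    by rewrite !mxE [in RHS]rmorphB opprB.
  rewrite normrN norm_conjC (le_trans (entry_le_norm _ _))//.
  by move: wv; rewrite -ball_normE => /ltW.
have Om_symmap v : ball w d v -> exists2 z, polydisc R n z & symmap z = conjv v.
  by move=> /Om_root[z zr zv]; exists z => // i; exact: le_lt_trans r1.
have Om_bound v : ball w d v -> forall a, `|eval_coef q v a| <= B' * \prod_i rho ^+ a i.
  move=> /Om_root[z zr zv] a; rewrite /eval_coef normrM norm_conjC -zv normfV normr_nat.
  rewrite /B' [B / _]mulrC -mulrA; apply: ler_wpM2l; first by rewrite invr_ge0.
  exact: BP.
have Om_open : open (ball w d) by exact: ball_open.
exists (ball w d); split; [exact: Om_open|exact: ballxx| |].
  by move=> v /Om_symmap[z Dz zv]; exists z.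
exists (fun _ => eval_vec lambda x q); split => [_ v Ov|v Ov].
  exact: (eval_vec_differentiable l0 hfun_x hdot_x Om_open B'0 rho01 Om_bound Ov).
have [g0 gE] := eval_vec_fibre l0 hA hfun_x hdot_x qE Om_open B'0 rho01 Om_symmap Om_bound Ov.
split => [c|].
  rewrite big_ord1 => /eqP; rewrite scaler_eq0 (negbTE g0) orbF => /eqP c0 i.
  by rewrite (ord1 i).
rewrite -gE; apply/seteqP; split=> [f [c ->]|f [c ->]].
  by exists (c ord0); rewrite big_ord1.
by exists (fun=> c); rewrite big_ord1.
Qed.

Theorem corollary4p16 (R : realType) (n : nat) (lambda : R)
    (A : holHilbert (polydisc R n)) :
  (1 <= n)%N -> 0 < lambda -> is_weighted_bergman lambda A ->
  locally_free (symmetric_part A) 1 (sympolydisc R n) /\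
  locally_free (antisymmetric_part A) 1 (sympolydisc R n).
Proof.
move=> _ l0 hA; split.
(* Two inversions cancel: [perm_act sigma^-1] is [col_perm sigma]. *)
- have -> : symmetric_part A = isotypic false.
    by apply/seteqP; split => f fM s z Dz; have := fM s z Dz; rewrite /perm_act invgK mul1r.
  exact: isotypic_locally_free hA.
- have -> : antisymmetric_part A = isotypic true.
    by apply/seteqP; split => f fM s z Dz; have := fM s z Dz; rewrite /perm_act invgK.
  exact: isotypic_locally_free hA.
Qed.
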